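(* Let $\mathcal{O}_{ad}$ be a family of open subsets of $\mathbb{R}^d$. Assume that a functional $\mathcal{J}\colon\mathcal{O}_{ad}\to\mathbb{R}$ admits a topological derivative at $\Omega\in\mathcal{O}_{ad}$, and let $\mu\in\mathcal{P}_2(\mathbb{R}^d)$ be such that $\Omega_\mu=\Omega$. For a fixed interior point $x_0\in\Omega$, let $\varepsilon>0$ be such that $\overline{B_{2\varepsilon}(x_0)}\subset\Omega$. Let $\psi\in C_0^\infty(\mathbb{R}^d)$ be a rotationally symmetric function centered around $x_0$ satisfying $\psi=1$ on $\overline{B_\varepsilon(x_0)}$, $\psi=0$ on $\overline{B_{2\varepsilon}(x_0)^c}$ and $0\le\psi\le1$ on $\mathbb{R}^d$. Let $\phi(x)=|x-x_0|$ and let $\theta$ be the vector field on $\mathbb{R}^d\setminus\{x_0\}$ given by $\theta=\nabla(\psi\phi)$. Then $\theta\in T_\mu\mathcal{P}_2(\mathbb{R}^d)$. Moreover, if $\Phi_t\colon\mathbb{R}^d\setminus\{x_0\}\to\mathbb{R}^d$ is the one-parameter transformation generated by $\theta$ and $\mu_t:=\Phi_{t\sharp}\mu$, then $$\frac{1}{\alpha_d\,d!}\left(\frac{d}{dt}\right)^d_{t=0}\widetilde{\mathcal{J}}(\mu_t)=d_T\mathcal{J}(\Omega,x_0),$$ where $\alpha_d>0$ is the constant determined by $|B_r(0)|=\alpha_d r^d$.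
   Context: $\mathcal{P}_2(\mathbb{R}^d)$ is the set of Borel probability measures on $\mathbb{R}^d$ with finite second moment. $\Phi_\sharp\mu$ is the push-forward measure, $\Phi_\sharp\mu(A)=\mu(\Phi^{-1}(A))$. $B_r(x)$ is the ball of radius $r$ centered at $x$, and $|\cdot|$ applied to sets is Lebesgue measure. $C_0^\infty(\mathbb{R}^d)$ denotes the smooth compactly supported functions. The tangent space of $\mathcal{P}_2(\mathbb{R}^d)$ at $\mu$ is $$T_\mu\mathcal{P}_2(\mathbb{R}^d):=\overline{\{\nabla\varphi\mid\varphi\in C_0^\infty(\mathbb{R}^d)\}}^{L^2(\mu)},$$ the closure in the space of $\mathbb{R}^d$-valued $\mu$-square-integrable vector fields. For $\mu\in\mathcal{P}_2(\mathbb{R}^d)$ put $\Omega_\mu:=\mathrm{Int}(\mathrm{supp}[\mu])$ (interior of the support). Put $\mathcal{P}_{ad}(\mathbb{R}^d):=\{\mu\in\mathcal{P}_2(\mathbb{R}^d)\mid\Omega_\mu\in\mathcal{O}_{ad}\}$ and $\widetilde{\mathcal{J}}(\mu):=\mathcal{J}(\Omega_\mu)$ for $\mu\in\mathcal{P}_{ad}(\mathbb{R}^d)$. A functional $\mathcal{J}\colon\mathcal{O}_{ad}\to\mathbb{R}$ admits a topological derivative at $\Omega\in\mathcal{O}_{ad}$ (for ball-shaped holes, with rate equal to the volume of the hole) if the limit $$d_T\mathcal{J}(\Omega,z):=\lim_{\varepsilon\to0}\frac{\mathcal{J}(\Omega\setminus\overline{B_\varepsilon(z)})-\mathcal{J}(\Omega)}{|B_\varepsilon(0)|}$$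 exists for every $z\in\Omega$; the function $z\mapsto d_T\mathcal{J}(\Omega,z)$ is called the topological derivative at $\Omega$.
   Formalization: For d≥2 the iterated d-th derivative at t=0 need not exist; the formal claim is that the d-th right derivative exists in the Taylor (Peano) sense with the stated value, and the iterated one has that value whenever it exists. The flow and derivative are taken for t≥0 only. *)

(* Defs.v *)
(* MathComp / MathComp-Analysis; R is an arbitrary realType and R^d is 'rV[R]_d. *)
From HB Require Import structures.
From mathcomp Require Import all_boot all_order all_algebra.
From mathcomp Require Import all_classical all_reals all_analysis.
Set Implicit Arguments.
Unset Strict Implicit.
Unset Printing Implicit Defensive.
Import Order.TTheory GRing.Theory Num.Theory.
Import numFieldNormedType.Exports.
Local Open Scope classical_set_scope.
Local Open Scope ring_scope.

(* R^d with its Borel sigma-algebra *)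
Notation borelRd R d := (g_sigma_algebraType (@open 'rV[R]_d)).

Section euclidean.
Context {R : realType} {d : nat}.
Implicit Types (x a b : 'rV[R]_d) (A : set 'rV[R]_d).

(* The library's norm on 'rV[R]_d is the sup norm (it induces the same topology
   as the Euclidean norm), hence the explicit Euclidean norm and balls. *)
Definition enorm x : R := Num.sqrt (\sum_i x 0 i ^+ 2).

Definition eball x (r : R) : set 'rV[R]_d := [set y | enorm (y - x) < r].

Definition box a b : set 'rV[R]_d := [set x | forall i, a 0 i <= x 0 i <= b 0 i].

Definition box_volume a b : R := \prod_i Num.max 0 (b 0 i - a 0 i).

(* d-dimensional Lebesgue (outer) measure |A|: infimum of the total volume over
   the countable covers of A by boxes *)
Definition lebesgue_volume A : \bar R :=
  ereal_inf [set (\sum_(0 <= k <oo) (box_volume (u k).1 (u k).2)%:E)%E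
    | u in [set u : nat -> 'rV[R]_d * 'rV[R]_d |
             A `<=` \bigcup_k box (u k).1 (u k).2]].

End euclidean.

Section test_functions.
Context {R : realType} {d : nat}.
Implicit Types f : 'rV[R]_d -> R.

Definition partial f (i : 'I_d) : 'rV[R]_d -> R :=
  fun x => 'D_(delta_mx 0 i) f x.

Definition grad f : 'rV[R]_d -> 'rV[R]_d := fun x => \row_i partial f i x.

(* C^oo: the iterated partial derivatives of all orders exist and are continuous *)
Definition smooth f := forall s : seq 'I_d,
  continuous (foldl partial f s) /\
  forall x i, derivable (foldl partial f s) x (delta_mx 0 i).

(* C_0^oo(R^d) *)
Definition test_function f :=
  smooth f /\ compact (closure [set x | f x != 0]).

End test_functions.

Section wasserstein.
Context {R : realType} {d : nat}.

Definition P2 : set (probability (borelRd R d) R) :=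
  [set mu | (\int[mu]_(x in [set: borelRd R d]) (enorm x ^+ 2)%:E < +oo)%E].

Definition L2norm (mu : probability (borelRd R d) R)
    (v : 'rV[R]_d -> 'rV[R]_d) : \bar R :=
  ('N[mu]_2%:E[(fun x : borelRd R d => (enorm (v x))%:E)])%E.

(* Closure in L^2(mu; R^d) of the gradients of test functions. Elements are
   represented by everywhere defined vector fields; membership is invariant
   under modification on mu-null sets by Borel fields. *)
Definition tangent_space (mu : probability (borelRd R d) R) :
    set ('rV[R]_d -> 'rV[R]_d) :=
  [set v : 'rV[R]_d -> 'rV[R]_d |
          [/\ measurable_fun setT (v : borelRd R d -> borelRd R d),
               (L2norm mu v < +oo)%E &
               forall e : R, 0 < e -> exists2 f : 'rV[R]_d -> R,
                 test_function f & (L2norm mu (fun x => (grad f x - v x)%R) < e%:E)%E]].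

(* The next notions are stated for a plain set function on R^d so that they
   apply directly to pushforward mu f. *)
Implicit Type nu : set (borelRd R d) -> \bar R.

Definition supp nu : set 'rV[R]_d :=
  [set x | forall U : set 'rV[R]_d, open U -> U x -> (0 < nu U)%E].

(* Omega_nu *)
Definition supp_int nu : set 'rV[R]_d := interior (supp nu).

Definition Pad (Oad : set (set 'rV[R]_d)) nu :=
  (exists2 P : probability (borelRd R d) R, P2 P & nu = P) /\ Oad (supp_int nu).

Definition Jtilde (J : set 'rV[R]_d -> R) nu : R := J (supp_int nu).

End wasserstein.

Section topological_derivative.
Context {R : realType} {d : nat}.
(* A functional Oad -> R is given by a function on all sets, of which only the
   values on members of Oad matter. *)
Variables (Oad : set (set 'rV[R]_d)) (J : set 'rV[R]_d -> R).

Definition perforate (Om : set 'rV[R]_d) z (e : R) := Om `\` closure (eball z e).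

Definition topological_quotient Om z (e : R) : R :=
  (J (perforate Om z e) - J Om) / fine (lebesgue_volume (@eball R d 0 e)).

(* The limit presupposes that small perforations of Om are in the domain of J. *)
Definition admits_topological_derivative Om :=
  Oad Om /\ forall z, Om z ->
    (\forall e \near (0 : R)^'+, Oad (perforate Om z e)) /\
    cvg (topological_quotient Om z @ (0 : R)^'+).

Definition topological_derivative Om z : R :=
  lim (topological_quotient Om z @ (0 : R)^'+).

End topological_derivative.

(* Forward flow of the vector field theta on R^d \ {x0}. Trajectories may reach x0
   in finite negative time, so the map Phi t is defined on the whole of
   R^d \ {x0} for t >= 0 only. Values Phi t x0 are unconstrained. *)
Definition flow_off {R : realType} {d : nat} (x0 : 'rV[R]_d)
    (theta : 'rV[R]_d -> 'rV[R]_d) (Phi : R -> 'rV[R]_d -> 'rV[R]_d) :=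
  forall x, x != x0 ->
  [/\ Phi 0 x = x,
      Phi t x @[t --> (0 : R)^'+] --> x &
      forall t : R, 0 < t ->
        Phi t x != x0 /\ is_derive t 1 (Phi ^~ x) (theta (Phi t x))].

Section higher_derivatives.
Context {R : realType}.
Implicit Types (f : R -> R) (a L : R) (n : nat).

(* n-th right derivative at a as the n-th coefficient of the Taylor expansion
   f (a + h) = f a + c_1 h + ... + c_n h^n / n! + o(h^n), h -> 0+
   (Peano derivative) *)
Definition is_peano_rderive n f a L := exists c : nat -> R,
  [/\ c 0%N = f a, c n = L &
      (f (a + h) - \sum_(k < n.+1) c k / k`!%:R * h ^+ k) / h ^+ n
        @[h --> (0 : R)^'+] --> (0 : R)].

(* n-th derivative at a, iterated, of a function of interest on [a, a + delta)
   only: one-sided at the end point a, ordinary to the right of a *)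
Definition is_iter_rderive n f a L := exists g : nat -> R -> R,
  [/\ g 0%N = f, g n a = L,
      forall k, (k.+1 < n)%N ->
        \forall t \near a^'+, is_derive (t : R) (1 : R) (g k) (g k.+1 t) &
      forall k, (k < n)%N ->
        h^-1 * (g k (a + h) - g k a) @[h --> (0 : R)^'+] --> g k.+1 a].

End higher_derivatives.

(* Main.v *)
Require Import Defs.
From HB Require Import structures.
From mathcomp Require Import all_boot all_order all_algebra.
From mathcomp Require Import all_classical all_reals all_analysis.
From mathcomp Require Import measurable_realfun ring lra.
Set Implicit Arguments.
Unset Strict Implicit.
Unset Printing Implicit Defensive.
Import Order.TTheory GRing.Theory Num.Theory.
Import numFieldNormedType.Exports.
Local Open Scope classical_set_scope.
Local Open Scope ring_scope.

(* Along theta the direction (x - x0)/|x - x0| is constant and the radius s solves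
   s' = h(s), where h(r) = (r p(r))' and psi(x) = p(|x - x0|); here h = 1 on
   (0, eps), h = 0 beyond 2 eps, and h is Lipschitz. By Gronwall's inequality the
   radii depend continuously and strictly monotonically on their initial value,
   small radii r move to r + t, and radii beyond 2 eps stay. Hence, for t < eps,
   Phi_t maps the complement of x0 onto the complement of the closed t-ball and
   the interior of the support of mu_t is Omega without the closed t-ball (an
   atom of mu at x0 contributes at most one further point to the support). The
   quotient of the topological derivative is then a Taylor expansion of order d
   of t |-> J(Omega_{mu_t}), and such expansions are unique.

   For theta in T_mu, the potential psi |x - x0| is replaced by
   psi (sqrt(|x - x0|^2 + D^2) + D^2 <v, x - x0> / (|x - x0|^2 + D^2)), whose
   gradient tends to theta off x0 and equals v = theta(x0) at x0, which matters
   when mu has an atom there. *)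

(** * Taylor expansions with Peano remainder *)

Section right_neighborhoods.
Context {R : realType}.
Implicit Types (a l : R) (f : R -> R) (P : R -> Prop).

Lemma near_rightP a P : (\forall t \near a^'+, P t) <->
  exists2 D : R, 0 < D & forall h, 0 < h < D -> P (a + h).
Proof.
split.
  move=> [D /= D0 HD]; exists D => // h /andP[h0 hD].
  apply: HD => /=; last by rewrite ltrDl.
  by rewrite opprD addrA subrr sub0r normrN gtr0_norm.
move=> [D D0 HD]; exists D => //= t /= atD at0.
rewrite -(subrK a t) addrC; apply: HD; rewrite subr_gt0 at0 /=.
by rewrite distrC gtr0_norm ?subr_gt0 in atD.
Qed.

Lemma cvg_rightP a l f : f t @[t --> a^'+] --> l <->
  forall e : R, 0 < e ->
    exists2 D : R, 0 < D & forall h, 0 < h < D -> `|f (a + h) - l| < e.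
Proof.
split => [/cvgrPdistC_lt H e e0|H].
  by have /near_rightP := H e e0.
by apply/cvgrPdistC_lt => e e0; apply/near_rightP; exact: H.
Qed.

Lemma cvg_right0P l f : f t @[t --> (0 : R)^'+] --> l <->
  forall e : R, 0 < e ->
    exists2 D : R, 0 < D & forall h, 0 < h < D -> `|f h - l| < e.
Proof.
rewrite cvg_rightP; split => H e /H [D D0 HD]; exists D => // h /HD;
  by rewrite add0r.
Qed.

Lemma cvg_right0_ext l f g : (forall h, 0 < h -> f h = g h) ->
  f t @[t --> (0 : R)^'+] --> l -> g t @[t --> (0 : R)^'+] --> l.
Proof.
move=> fg /cvg_right0P H; apply/cvg_right0P => e /H[D D0 HD].
by exists D => // h /[dup] hD /HD; rewrite fg//; case/andP: hD.
Qed.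

(** Flow lines are known at time 0 only through a limit from the right; this turns that limit into
    continuity on a closed interval, as [MVT] and [IVT] require. *)
Lemma within_right_continuous (a b : R) f : a < b ->
  f t @[t --> a^'+] --> f a -> (forall t, a < t <= b -> {for t, continuous f}) ->
  {within `[a, b], continuous f}.
Proof.
move=> ab fa fc; apply/continuous_within_itvP => //; split => //.
  by move=> t /[!in_itv]/= /andP[at0 tb]; apply: fc; rewrite at0 ltW.
by apply: cvg_at_left_filter; apply: fc; rewrite ab lexx.
Qed.

Lemma is_derive1_continuous f (t D : R) : is_derive t 1 f D -> {for t, continuous f}.
Proof.
by move=> H; apply/differentiable_continuous/derivable1_diffP; apply: ex_derive.
Qed.

End right_neighborhoods.

Section peano.
Context {R : realType}.

(* The remainder of order n of g 0 is estimated by the mean value theorem from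
   the remainder of order n - 1 of g 1. *)
Lemma taylor_peano n (g : nat -> R -> R) :
  (forall k, (k < n)%N -> \forall t \near (0 : R)^'+, is_derive (t : R) (1 : R) (g k) (g k.+1 t)) ->
  (forall k, (k < n.+1)%N -> h^-1 * (g k (0 + h) - g k 0) @[h --> (0 : R)^'+] --> g k.+1 0) ->
  (g 0%N h - \sum_(k < n.+2) g k 0 / k`!%:R * h ^+ k) / h ^+ n.+1
        @[h --> (0 : R)^'+] --> (0 : R).
Proof.
elim: n g => [|n IH] g gd gq.
  have /cvg_right0P H := gq 0%N (ltn0Sn 0).
  apply/cvg_right0P => e /H[D D0 HD]; exists D => // h hD.
  have := HD h hD; rewrite add0r !big_ord_recl big_ord0 /=.
  have h0 : h != 0 by move: hD => /andP[/gt_eqF ->].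
  congr (_ < _); congr (`| _ |).
  by rewrite /bump /= fact0 factS fact0 expr0 expr1 invr1 subr0; field.
have {IH}/cvg_right0P IH := IH (fun k => g k.+1) (fun k kn => gd k.+1 kn) (fun k kn => gq k.+1 kn).
have /near_rightP[D1 D10 HD1] := gd 0%N (ltn0Sn n).
(* A convergent difference quotient is bounded near 0 by [M = |g 1 0| + 1], so the increment of
   [g 0] is at most [h * M]. *)
have g0c : g 0%N t @[t --> (0 : R)^'+] --> g 0%N 0.
  have /cvg_right0P H := gq 0%N (ltn0Sn n.+1).
  apply/cvg_right0P => e e0; have [D D0 HD] := H 1 ltr01.
  pose M := `|g 1%N 0| + 1.
  have M0 : 0 < M by rewrite ltr_wpDl.
  exists (Num.min D (e / M)); first by rewrite lt_min D0 divr_gt0.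
  move=> h /andP[h0]; rewrite lt_min => /andP[hD he].
  have hq : `|h^-1 * (g 0%N h - g 0%N 0)| < M.
    have := HD h; rewrite h0 hD add0r => /(_ isT) H1.
    rewrite -(subrK (g 1%N 0) (_ * _)).
    by rewrite (le_lt_trans (ler_normD _ _))// /M addrC ltrD2l.
  rewrite -(mulVKf (lt0r_neq0 h0) (g 0%N h - g 0%N 0)) normrM gtr0_norm//.
  rewrite (@lt_trans _ _ (h * M))//; first by rewrite ltr_pM2l.
  by rewrite -ltr_pdivlMr.
apply/cvg_right0P => e /IH[D D0 HD].
pose B := Num.min D D1.
exists B; first by rewrite lt_min D0 D10.
move=> h /andP[h0]; rewrite lt_min => /andP[hD hD1].
pose P (m : nat) (c : nat -> R) : R -> R := fun x => \sum_(k < m) c k / k`!%:R * x ^+ k.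
(* Differentiating a Taylor polynomial shifts its coefficients, so the derivative of [Rm] is the
   remainder of [g 1], of order one less. *)
pose Rm := fun x => g 0%N x - P n.+3 (fun k => g k 0) x.
have dP m c (x : R) : is_derive x 1 (P m.+1 c) (P m (fun k => c k.+1) x).
  elim: m => [|m IHm].
    have -> : P 1%N c = cst (c 0%N).
      by apply/funext => y; rewrite /P big_ord_recl big_ord0 fact0 invr1 expr0 !mulr1 addr0.
    by rewrite /P big_ord0; apply: is_derive_cst.
  have -> : P m.+2 c = P m.+1 c \+ (fun y => (c m.+1 / m.+1`!%:R) *: y ^+ m.+1).
    by apply/funext => y; rewrite /P big_ord_recr.
  have -> : P m.+1 (fun k => c k.+1) x = P m (fun k => c k.+1) x +
      (c m.+1 / m.+1`!%:R) *: (m.+1%:R *: x ^+ m).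
    rewrite {1}/P big_ord_recr /=; congr (_ + _).
    rewrite /GRing.scale /= factS natrM.
    have m1 : (m.+1%:R : R) != 0 by rewrite pnatr_eq0.
    have mf : (m`!%:R : R) != 0 by rewrite pnatr_eq0 -lt0n fact_gt0.
    move: (m.+1%:R : R) (m`!%:R : R) m1 mf => u w u0 w0.
    by field; rewrite ?u0 ?w0.
  apply: is_deriveD; apply: (is_deriveZ (f := fun y : R => y ^+ m.+1)).
  by apply: DeriveDef; [exact: exprn_derivable|rewrite exp_derive /= /GRing.scale /= mulr1].
have dR x : 0 < x < D1 -> is_derive x 1 Rm (g 1%N x - P n.+2 (fun k => g k.+1 0) x).
  by move=> xD; apply: is_deriveB; have := HD1 x xD; rewrite add0r.
have cR : {within `[0, h], continuous Rm}.
  apply: within_right_continuous => //; last first.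
    move=> t /andP[t0 th]; apply: is_derive1_continuous; apply: dR.
    by rewrite t0 (le_lt_trans th).
  apply: cvgB; first exact: g0c.
  by apply: cvg_at_right_filter; have := dP n.+2 (fun k => g k 0) 0; apply: is_derive1_continuous.
have dR0 x : x \in `]0, h[%R -> is_derive x 1 Rm (g 1%N x - P n.+2 (fun k => g k.+1 0) x).
  by rewrite in_itv /= => /andP[x0 xh]; apply: dR; rewrite x0 (lt_trans xh).
have [c] := MVT h0 dR0 cR; rewrite in_itv /= => /andP[c0 ch].
have R0 : Rm 0 = 0.
  rewrite /Rm /P big_ord_recl big1 => [|i _].
    by rewrite fact0 invr1 expr0 !mulr1 addr0 subrr.
  by rewrite /bump /= expr0n mulr0.
rewrite R0 !subr0 => Rh.
have cD : 0 < c < D by rewrite c0 (lt_trans ch).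
have := HD c cD; rewrite !subr0.
have -> : g 0%N h - \sum_(k < n.+3) g k 0 / k`!%:R * h ^+ k = Rm h by [].
rewrite Rh.
rewrite !normrM !normrV ?unitfE ?expf_neq0 ?gt_eqF// !normrX !(gtr0_norm h0) !(gtr0_norm c0) => Hc.
(* The factor [h] from the mean value theorem cancels one power of [h]; the remaining power exceeds
   that of [c] because [c < h]. *)
apply: le_lt_trans Hc; rewrite [h ^+ n.+2]exprS invfM mulrA mulfK ?gt_eqF//.
apply: ler_wpM2l => //; rewrite lef_pV2 ?posrE ?exprn_gt0//.
by rewrite lerXn2r ?nnegrE ?ltW.
Qed.

(** Multiplying back by [h ^+ n] shows that the constant term tends to 0, hence vanishes; a factor
    [h] then cancels and the degree drops. *)
Lemma peano_polynomial_eq0 n (b : nat -> R) :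
  (\sum_(k < n.+1) b k * h ^+ k) / h ^+ n @[h --> (0 : R)^'+] --> (0 : R) ->
  forall k, (k <= n)%N -> b k = 0.
Proof.
elim: n b => [|n IH] b bn.
  move=> k; rewrite leqn0 => /eqP ->.
  have : (\sum_(k < 1) b k * h ^+ k) / h ^+ 0 @[h --> (0 : R)^'+] --> b 0%N.
    under eq_fun do rewrite big_ord1 expr0 mulr1 invr1 mulr1.
    exact: cvg_cst.
  by move=> H; exact: (cvg_unique (@norm_hausdorff _ _) H bn).
have pc m : continuous (fun h : R => \sum_(k < m) b k * h ^+ k).
  elim: m => [|m IHm] x.
    have -> : (fun h : R => \sum_(k < 0) b k * h ^+ k) = cst 0.
      by apply/funext => h; rewrite big_ord0.
    exact: cvg_cst.
  have -> : (fun h : R => \sum_(k < m.+1) b k * h ^+ k) =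
      (fun h => \sum_(k < m) b k * h ^+ k) \+ (fun h => b m * h ^+ m).
    by apply/funext => h; rewrite big_ord_recr.
  apply: cvgD; first exact: IHm.
  by apply: cvgM; [exact: cvg_cst|exact: exprn_continuous].
have b0 : b 0%N = 0.
  have H1 : \sum_(k < n.+2) b k * h ^+ k @[h --> (0 : R)^'+] --> b 0%N.
    have := cvg_at_right_filter (pc n.+2 0).
    rewrite big_ord_recl big1 ?addr0 ?expr0 ?mulr1// => i _.
    by rewrite /bump /= expr0n mulr0.
  have H2 : \sum_(k < n.+2) b k * h ^+ k @[h --> (0 : R)^'+] --> (0 : R).
    have H2 : (\sum_(k < n.+2) b k * h ^+ k) / h ^+ n.+1 * h ^+ n.+1
        @[h --> (0 : R)^'+] --> (0 * 0 ^+ n.+1 : R).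
      by apply: cvgM => //; apply: cvg_at_right_filter; exact: exprn_continuous.
    rewrite mul0r in H2; apply: (cvg_right0_ext _ H2) => h h0.
    by rewrite /= divfK// expf_neq0// gt_eqF.
  exact: (cvg_unique (@norm_hausdorff _ _) H1 H2).
have bS : (\sum_(k < n.+1) b k.+1 * h ^+ k) / h ^+ n @[h --> (0 : R)^'+] --> (0 : R).
  apply: cvg_right0_ext bn => h /gt_eqF h0.
  rewrite big_ord_recl b0 mul0r add0r.
  under eq_bigr do rewrite exprS mulrCA.
  by rewrite -mulr_sumr exprS invfM mulrACA divff ?mul1r// h0.
by case=> // k kn; exact: (IH (fun k => b k.+1)).
Qed.

End peano.

(** * Directional derivatives through restriction to a line *)

Section derive_along.
Context {R : realType} {V : normedModType R}.
Implicit Types (f g : V -> R) (x v : V).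

(** Reduces a directional derivative to one real variable, where the chain rule [is_derive1_comp]
    applies. *)
Lemma is_derive_alongP f x v (D : R) :
  is_derive x v f D <-> is_derive (0 : R) (1 : R) (fun h : R => f (h *: v + x)) D.
Proof.
have E : 'D_v f x = 'D_(1 : R) (fun h : R => f (h *: v + x)) (0 : R).
  rewrite /derive; congr (lim (_ @ 0^')); apply/funext => h /=.
  by rewrite addr0 scale0r add0r [_ *: 1]mulr1.
split=> -[H1 H2].
  by apply: DeriveDef; [exact: (derivable1P _ _ _).1|rewrite -E].
by apply: DeriveDef; [exact: (derivable1P _ _ _).2|rewrite E].
Qed.

Lemma is_derive_comp_along (phi : R -> R) f x v (a b : R) :
  is_derive (f x) (1 : R) phi a -> is_derive x v f b ->
  is_derive x v (fun y => phi (f y)) (a * b).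
Proof.
move=> Hphi /is_derive_alongP Hf; apply/is_derive_alongP.
apply: (is_derive1_comp (f := phi) (g := fun h : R => f (h *: v + x))) => //.
by rewrite scale0r add0r.
Qed.

Lemma is_derive_addf f g x v (a b : R) : is_derive x v f a -> is_derive x v g b ->
  is_derive x v (fun y => f y + g y) (a + b).
Proof. exact: is_deriveD. Qed.

Lemma is_derive_mulf f g x v (a b : R) : is_derive x v f a -> is_derive x v g b ->
  is_derive x v (fun y => f y * g y) (a * g x + f x * b).
Proof.
move=> Hf Hg; have -> : (fun y => f y * g y) = f * g by [].
apply: (is_derive_eq (is_deriveM Hf Hg)).
by rewrite /GRing.scale /= addrC (mulrC a).
Qed.

Lemma is_derive_sumf n (F : 'I_n -> V -> R) x v (D : 'I_n -> R) :
  (forall i, is_derive x v (F i) (D i)) ->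
  is_derive x v (fun y => \sum_i F i y) (\sum_i D i).
Proof.
move=> HF; have := is_derive_sum HF.
by congr is_derive; apply/funext => y; rewrite fct_sumE.
Qed.

(** Stated for arbitrary coordinate functions, so that it serves both for the norm as a function of
    the point and for the radius as a function of time. *)
Lemma is_derive_sqrt_sum_sqr n (c : 'I_n -> V -> R) x v (D : 'I_n -> R) :
  (forall i, is_derive x v (c i) (D i)) -> 0 < \sum_i c i x ^+ 2 ->
  is_derive x v (fun y => Num.sqrt (\sum_i c i y ^+ 2))
    ((\sum_i c i x * D i) / Num.sqrt (\sum_i c i x ^+ 2)).
Proof.
move=> Hc pos.
have Hs : is_derive x v (fun y => \sum_i c i y ^+ 2) (\sum_i 2 * (c i x * D i)).
  apply: is_derive_sumf => i.
  have -> : (fun y => c i y ^+ 2) = (fun y => c i y * c i y).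
    by apply/funext => y; rewrite expr2.
  by apply: (is_derive_eq (is_derive_mulf (Hc i) (Hc i))); ring.
apply: (is_derive_eq (is_derive_comp_along (is_derive1_sqrt pos) Hs)).
rewrite -mulr_sumr invfM; field.
by rewrite gt_eqF// sqrtr_gt0.
Qed.

End derive_along.

Lemma is_derive_entry {R : realType} {V : normedModType R} {d} (G : V -> 'rV[R]_d)
    x v (D : 'rV[R]_d) i :
  is_derive x v G D -> is_derive x v (fun y => G y 0 i) (D 0 i).
Proof.
move=> [dG <-]; rewrite derive_mx// mxE; apply: DeriveDef => //.
exact: (derivable_mxP _ _ _).1.
Qed.

Lemma is_derive_coord {R : realType} {d} (x v : 'rV[R]_d) i :
  is_derive x v (fun y : 'rV[R]_d => y 0 i) (v 0 i).
Proof. exact: (is_derive_entry i (is_derive_id x v)). Qed.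

(** * The Euclidean norm and its derivative *)

Section enorm_theory.
Context {R : realType} {d : nat}.
Implicit Types (x y v : 'rV[R]_d).

Lemma enorm_ge0 x : 0 <= enorm x.
Proof. exact: sqrtr_ge0. Qed.

Lemma sum_sqr_ge0 x : 0 <= \sum_i x 0 i ^+ 2.
Proof. by apply: sumr_ge0 => i _; rewrite sqr_ge0. Qed.

Lemma sqr_enorm x : enorm x ^+ 2 = \sum_i x 0 i ^+ 2.
Proof. by rewrite sqr_sqrtr// sum_sqr_ge0. Qed.

Lemma le_coord_enorm x i : `|x 0 i| <= enorm x.
Proof.
rewrite -sqrtr_sqr ler_wsqrtr// (bigD1 i)//= lerDl.
by apply: sumr_ge0 => j _; rewrite sqr_ge0.
Qed.

Lemma enorm_eq0 x : (enorm x == 0) = (x == 0).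
Proof.
apply/eqP/eqP => [x0|->].
  apply/rowP => i; rewrite mxE; apply/eqP.
  by rewrite -normr_le0 -x0 le_coord_enorm.
by rewrite /enorm big1 ?sqrtr0// => i _; rewrite mxE expr0n.
Qed.

Lemma enorm_gt0 x : (0 < enorm x) = (x != 0).
Proof. by rewrite lt_neqAle enorm_ge0 andbT eq_sym enorm_eq0. Qed.

Lemma enormB_gt0 x y : (0 < enorm (x - y)) = (x != y).
Proof. by rewrite enorm_gt0 subr_eq0. Qed.

Lemma enormZ a x : enorm (a *: x) = `|a| * enorm x.
Proof.
rewrite /enorm -sqrtr_sqr -sqrtrM ?sqr_ge0//; congr Num.sqrt.
by rewrite mulr_sumr; apply: eq_bigr => i _; rewrite mxE exprMn.
Qed.

Lemma enorm_delta i : enorm (delta_mx 0 i : 'rV[R]_d) = 1.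
Proof.
rewrite /enorm (bigD1 i)//= big1 => [|j ji]; last by rewrite mxE (negPf ji) expr0n.
by rewrite mxE !eqxx expr1n addr0 sqrtr1.
Qed.

Lemma le_enorm_bound x (B : R) : (forall i, `|x 0 i| <= B) ->
  enorm x ^+ 2 <= d%:R * B ^+ 2.
Proof.
move=> xB; rewrite sqr_enorm mulr_natl -[d in leRHS]card_ord -sumr_const.
apply: ler_sum => i _; rewrite -real_normK ?num_real//.
by rewrite lerXn2r// nnegrE ?(le_trans _ (xB i)).
Qed.

Lemma enorm_continuous : continuous (@enorm R d).
Proof.
move=> x; apply: (@continuous_comp _ _ _ (fun y : 'rV[R]_d => \sum_i y 0 i ^+ 2) Num.sqrt).
  apply: continuous_big => [|i _ y]; first exact: add_continuous.
  apply: (@continuous_comp _ _ _ (fun y : 'rV[R]_d => y 0 i) (fun r => r ^+ 2)).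
    exact: coord_continuous.
  exact: exprn_continuous.
exact: sqrt_continuous.
Qed.

Lemma enormB_continuous x0 : continuous (fun x => enorm (x - x0)).
Proof.
move=> x; apply: (@continuous_comp _ _ _ (fun y => y - x0) (@enorm R d)).
  exact: (@continuousB _ _ _ id (cst x0) x (@cvg_id _ _) (@cst_continuous _ _ _ x)).
exact: enorm_continuous.
Qed.

Lemma open_enorm_lt x0 r : open [set x | enorm (x - x0) < r].
Proof.
apply: (@open_comp _ _ (fun x => enorm (x - x0)) [set s | s < r]); last exact: open_lt.
by move=> x _; exact: enormB_continuous. Qed.

Lemma open_enorm_gt x0 r : open [set x | r < enorm (x - x0)].
Proof.
apply: (@open_comp _ _ (fun x => enorm (x - x0)) [set s | r < s]); last exact: open_gt.
by move=> x _; exact: enormB_continuous. Qed.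

Lemma is_derive_enormB x0 x v : x != x0 ->
  is_derive x v (fun y => enorm (y - x0))
    ((\sum_i (x - x0) 0 i * v 0 i) / enorm (x - x0)).
Proof.
move=> xx0.
apply: (is_derive_sqrt_sum_sqr (c := fun i (y : 'rV[R]_d) => (y - x0) 0 i)); last first.
  by rewrite -sqr_enorm exprn_gt0// enormB_gt0.
move=> i; have : is_derive x v (fun y : 'rV[R]_d => y 0 i - x0 0 i) (v 0 i - 0).
  by apply: is_deriveB; exact: is_derive_coord.
by rewrite subr0; congr is_derive; apply/funext => y; rewrite !mxE.
Qed.

Lemma is_derive_enormB_delta x0 x i : x != x0 ->
  is_derive x (delta_mx 0 i) (fun y => enorm (y - x0))
    ((x - x0) 0 i / enorm (x - x0)).
Proof.
move=> /(is_derive_enormB (delta_mx 0 i)) H; apply: (is_derive_eq H).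
rewrite (bigD1 i)//= big1 ?addr0 => [|j ji]; rewrite [delta_mx _ _ _ _]mxE eqxx.
  by rewrite eqxx mulr1.
by rewrite (negPf ji) mulr0.
Qed.

End enorm_theory.

(** * Autonomous equations on the half-line *)

Section one_dimensional_flow.
Context {R : realType}.
Implicit Types (f s w h : R -> R) (T t r K : R).

Lemma right_mean_value f (Df : R -> R) T : 0 < T ->
  f t @[t --> (0 : R)^'+] --> f 0 ->
  (forall t, 0 < t <= T -> is_derive t (1 : R) f (Df t)) ->
  exists2 c, 0 < c < T & f T - f 0 = Df c * T.
Proof.
move=> T0 f0 df.
have dfi x : x \in `]0, T[%R -> is_derive x 1 f (Df x).
  by rewrite in_itv /= => /andP[x0 /ltW xT]; apply: df; rewrite x0.
have cf : {within `[0, T], continuous f}.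
  apply: within_right_continuous => // t tT.
  exact: is_derive1_continuous (df t tT).
have [c] := MVT T0 dfi cf; rewrite in_itv /= subr0 => cT ->.
by exists c.
Qed.

(** The derivative of [w t * expR (c * t)] is nonnegative for [c = K] and nonpositive for [c = - K];
    the mean value theorem compares the times 0 and [T]. The lower bound is what later keeps
    trajectories apart. *)
Lemma gronwall w (Dw : R -> R) K T : 0 <= T ->
  w t @[t --> (0 : R)^'+] --> w 0 ->
  (forall t, 0 < t <= T -> is_derive t (1 : R) w (Dw t)) ->
  (forall t, 0 < t <= T -> `|Dw t| <= K * w t) ->
  w 0 * expR (- K * T) <= w T <= w 0 * expR (K * T).
Proof.
rewrite le_eqVlt => /predU1P[<- _ _ _|T0 w0 dw Kw].
  by rewrite !mulr0 expR0 mulr1 lexx.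
have dexp (c t : R) : is_derive t (1 : R) (fun t => expR (c * t)) (expR (c * t) * c).
  apply: (is_derive_comp_along (f := fun t => c * t)) => //.
  have := is_derive_mulf (is_derive_cst c t 1) (is_derive_id t 1).
  by rewrite mul0r add0r mulr1.
have exp_cts (c : R) : expR (c * t) @[t --> (0 : R)^'+] --> expR (c * 0).
  by apply: cvg_at_right_filter; apply: is_derive1_continuous (dexp c 0).
have mv (c : R) : exists2 u, 0 < u < T & w T * expR (c * T) - w 0 * expR (c * 0) =
    (Dw u * expR (c * u) + w u * (expR (c * u) * c)) * T.
  apply: (@right_mean_value (fun t => w t * expR (c * t))
    (fun u => Dw u * expR (c * u) + w u * (expR (c * u) * c))) => //.
    exact: cvgM.
  by move=> t tT; exact: (is_derive_mulf (dw t tT) (dexp c t)).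
have E (c t : R) : Dw t * expR (c * t) + w t * (expR (c * t) * c) =
    expR (c * t) * (Dw t + c * w t) by ring.
apply/andP; split.
  have [c /andP[c0 cT]] := mv K; rewrite mulr0 expR0 mulr1 E => H.
  rewrite mulNr expRN ler_pdivrMr ?expR_gt0// -subr_ge0 H.
  apply: mulr_ge0 (ltW T0); apply: mulr_ge0; first exact: expR_ge0.
  have : 0 < c <= T by rewrite c0 ltW.
  by move=> /Kw; rewrite ler_norml => /andP[? _]; lra.
have [c /andP[c0 cT]] := mv (- K); rewrite mulr0 expR0 mulr1 E => H.
rewrite -ler_pdivrMr ?expR_gt0// -expRN -mulNr -subr_le0 H.
apply: mulr_le0_ge0 (ltW T0); apply: mulr_ge0_le0; first exact: expR_ge0.
have : 0 < c <= T by rewrite c0 ltW.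
by move=> /Kw; rewrite ler_norml => /andP[_ ?]; lra.
Qed.

Definition trajectory h T s :=
  s t @[t --> (0 : R)^'+] --> s 0 /\
  forall t, 0 < t <= T -> is_derive t (1 : R) s (h (s t)).

Lemma trajectory_le h T T' s : T' <= T -> trajectory h T s -> trajectory h T' s.
Proof.
move=> TT [s0 ds]; split=> // t /andP[t0 tT]; apply: ds.
by rewrite t0 (le_trans tT).
Qed.

Lemma trajectory_cst h T r : h r = 0 -> trajectory h T (cst r).
Proof.
by move=> h0; split=> [|t _]; [exact: cvg_cst|rewrite h0; exact: is_derive_cst].
Qed.

Variables (h : R -> R) (K : R).
Hypothesis h_lip : forall r r', `|h r - h r'| <= K * `|r - r'|.

Lemma lipschitz_ge0 : 0 <= K.
Proof.
have := h_lip 1 0; rewrite subr0 normr1 mulr1; exact: le_trans.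
Qed.

(** The squared distance, unlike the distance, is differentiable even where trajectories might meet;
    its derivative is at most [2 * K] times itself, so [gronwall] applies. *)
Lemma trajectory_dist s s' T : 0 <= T -> trajectory h T s -> trajectory h T s' ->
  (s 0 - s' 0) ^+ 2 * expR (- (2 * K) * T) <= (s T - s' T) ^+ 2
    <= (s 0 - s' 0) ^+ 2 * expR ((2 * K) * T).
Proof.
move=> T0 [s0 ds] [s'0 ds'].
have cB : (s t - s' t) @[t --> (0 : R)^'+] --> s 0 - s' 0 by apply: cvgB.
have dB t : 0 < t <= T -> is_derive t (1 : R) (fun t => s t - s' t) (h (s t) - h (s' t)).
  by move=> tT; apply: is_deriveB; [exact: ds|exact: ds'].
apply: (gronwall (w := fun t => (s t - s' t) ^+ 2)
  (Dw := fun t => 2 * ((h (s t) - h (s' t)) * (s t - s' t)))) => //.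
- rewrite expr2; under eq_fun do rewrite expr2.
  exact: cvgM.
- move=> t tT.
  have -> : (fun t => (s t - s' t) ^+ 2) = (fun t => (s t - s' t) * (s t - s' t)).
    by apply/funext => u; rewrite expr2.
  by apply: (is_derive_eq (is_derive_mulf (dB t tT) (dB t tT))); ring.
- move=> t tT; rewrite !normrM ger0_norm// -mulrA ler_pM2l//.
  rewrite -[X in _ <= _ * X]real_normK ?num_real// expr2 mulrA.
  by apply: ler_wpM2r.
Qed.

Lemma trajectory_eq s s' T : 0 <= T -> trajectory h T s -> trajectory h T s' ->
  s 0 = s' 0 -> s T = s' T.
Proof.
move=> T0 Hs Hs' E; have := trajectory_dist T0 Hs Hs'.
rewrite E subrr expr0n /= !mul0r => /andP[H1 H2].
by apply/eqP; rewrite -subr_eq0 -sqrf_eq0 eq_le H1 H2.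
Qed.

(** If the order were lost, the intermediate value theorem would give a meeting time, against the
    lower bound of [trajectory_dist]. *)
Lemma trajectory_lt s s' T : 0 <= T -> trajectory h T s -> trajectory h T s' ->
  s 0 < s' 0 -> s T < s' T.
Proof.
move=> T0 Hs Hs' lt0; rewrite ltNge; apply/negP => leT.
move: T0; rewrite le_eqVlt => /predU1P[T0|T0].
  by move: leT; rewrite -T0 leNgt lt0.
have cB : {within `[0, T], continuous (fun t => s' t - s t)}.
  apply: within_right_continuous => //.
    by apply: cvgB; [exact: Hs'.1|exact: Hs.1].
  move=> t tT; apply: cvgB; apply: is_derive1_continuous;
    [exact: Hs'.2|exact: Hs.2].
have [|c cT c0] := IVT (v := 0) (ltW T0) cB.
  by rewrite ge_min le_max !subr_ge0 !subr_le0 leT (ltW lt0) orbT.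
move: cT; rewrite in_itv /= => /andP[c_ge0 cT].
have := trajectory_dist c_ge0 (trajectory_le cT Hs) (trajectory_le cT Hs').
rewrite -[s c - s' c]opprB c0 oppr0 expr0n /= => /andP[+ _].
apply/negP; rewrite -ltNge mulr_gt0 ?expR_gt0//.
by rewrite lt_neqAle sqr_ge0 andbT eq_sym sqrf_eq0 subr_eq0 lt_eqF.
Qed.

Lemma trajectory_lip s s' T : 0 <= T -> trajectory h T s -> trajectory h T s' ->
  `|s T - s' T| <= `|s 0 - s' 0| * expR (K * T).
Proof.
move=> T0 Hs Hs'; have /andP[_] := trajectory_dist T0 Hs Hs'.
rewrite -real_normK ?num_real// -[X in _ <= X * _]real_normK ?num_real//.
have -> : expR (2 * K * T) = expR (K * T) ^+ 2 by rewrite -mulrA -expRM_natl.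
by rewrite -exprMn ler_pXn2r// ?nnegrE// mulr_ge0 ?expR_ge0.
Qed.

Variables (eps : R) (S : R -> R -> R).
Hypothesis eps_gt0 : 0 < eps.
Hypothesis h_one : forall r, 0 < r < eps -> h r = 1.
Hypothesis h_zero : forall r, 2 * eps <= r -> h r = 0.
Hypothesis S0 : forall r, 0 < r -> S 0 r = r.
Hypothesis S_trajectory : forall T r, 0 < r -> trajectory h T (S^~ r).

Lemma flow1_lt t r r' : 0 <= t -> 0 < r -> r < r' -> S t r < S t r'.
Proof.
move=> t0 r0 rr'; have r'0 := lt_trans r0 rr'.
by apply: (trajectory_lt t0 (S_trajectory t r0) (S_trajectory t r'0)); rewrite !S0.
Qed.

(** The constant solves the same equation where [h] vanishes, and trajectories are determined by
    their initial value. *)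
Lemma flow1_far t r : 0 <= t -> 2 * eps <= r -> S t r = r.
Proof.
move=> t0 er; have r0 : 0 < r by rewrite (lt_le_trans _ er)// mulr_gt0.
apply: (trajectory_eq t0 (S_trajectory t r0) (trajectory_cst t (h_zero er))).
by rewrite S0.
Qed.

Lemma flow1_lt_far t r : 0 <= t -> 0 < r -> r < 2 * eps -> S t r < 2 * eps.
Proof. by move=> t0 r0 re; rewrite -[ltRHS](flow1_far t0 (lexx _)) flow1_lt. Qed.

Lemma flow1_near t r : 0 <= t -> 0 < r -> r + t < eps -> S t r = r + t.
Proof.
move=> t0 r0 re.
have H : trajectory h t (fun u => r + u).
  split=> [|u /andP[u0 ut]].
    by apply: cvgD; [exact: cvg_cst|exact: cvg_at_right_filter].
  rewrite h_one ?addr_gt0 ?(le_lt_trans _ re) ?lerD2l//.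
  have := is_derive_addf (is_derive_cst r u (1 : R)) (is_derive_id u 1).
  by rewrite add0r.
by apply: (trajectory_eq t0 (S_trajectory t r0) H); rewrite S0// addr0.
Qed.

(** By monotonicity it suffices to look at a smaller radius [a] with [a + t < eps], which moves to
    exactly [a + t]. *)
Lemma flow1_gt t r : 0 <= t < eps -> 0 < r -> t < S t r.
Proof.
move=> /andP[t0 te] r0; pose a := Num.min r (eps - t) / 2.
have m0 : 0 < Num.min r (eps - t) by rewrite lt_min r0 subr_gt0.
have a0 : 0 < a by rewrite divr_gt0.
have am : a < Num.min r (eps - t) by rewrite /a ltr_pdivrMr// mulr2n mulrDr mulr1 ltrDl.
move: am; rewrite lt_min ltrBrDr => /andP[ar ate].
by apply: lt_trans (flow1_lt t0 a0 ar); rewrite flow1_near// ltrDr.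
Qed.

Lemma flow1_continuous t r : 0 <= t -> 0 < r -> {for r, continuous (S t)}.
Proof.
move=> t0 r0; apply/cvgrPdist_lt => e e0.
have D0 : 0 < e * expR (- (K * t)) by rewrite mulr_gt0 ?expR_gt0.
near=> r'.
have r'0 : 0 < r' by near: r'; exact: lt_nbhsr.
have := trajectory_lip t0 (S_trajectory t r0) (S_trajectory t r'0).
move=> /le_lt_trans; apply; rewrite !S0//.
rewrite -ltr_pdivlMr ?expR_gt0// -expRN.
by near: r'; exact: cvgr_dist_lt.
Unshelve. all: by end_near. Qed.

(** Intermediate values between a small radius [a], sent to [a + t < r], and a radius [b >= r]
    beyond [2 * eps], which is fixed. *)
Lemma flow1_surjective t r : 0 <= t < eps -> t < r -> exists2 r', 0 < r' & S t r' = r.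
Proof.
move=> /andP[t0 te] tr; pose a := Num.min (r - t) (eps - t) / 2.
have m0 : 0 < Num.min (r - t) (eps - t) by rewrite lt_min !subr_gt0 tr.
have a0 : 0 < a by rewrite divr_gt0.
have am : a < Num.min (r - t) (eps - t) by rewrite /a ltr_pdivrMr// mulr2n mulrDr mulr1 ltrDl.
move: am; rewrite lt_min !ltrBrDr => /andP[ar ate].
pose b := Num.max (2 * eps) r.
have eb : 2 * eps <= b by rewrite le_max lexx.
have rb : r <= b by rewrite le_max lexx orbT.
have ab : a <= b.
  by apply: le_trans rb; apply: le_trans (ltW ar); rewrite lerDl.
have cS : {within `[a, b], continuous (S t)}.
  apply: continuous_in_subspaceT => u; rewrite inE /= in_itv /= => /andP[au _].
  by apply: flow1_continuous => //; exact: lt_le_trans au.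
have [|c cab Sc] := IVT (v := r) ab cS.
  rewrite flow1_near// (flow1_far t0 eb) ge_min (ltW ar) le_max.
  by rewrite rb orbT.
by exists c => //; move: cab; rewrite in_itv /= => /andP[ac _]; exact: lt_le_trans ac.
Qed.

End one_dimensional_flow.

(** * Radial vector fields and their flow *)

Section profile.
Context {R : realType}.

Lemma bounded_of_compact_support (f : R -> R) (c : R) : continuous f ->
  (forall r, c < `|r| -> f r = 0) -> exists B, forall r, `|f r| <= B.
Proof.
move=> cf f0; have [c0|c0] := ltP c 0.
  by exists 0 => r; rewrite f0 ?normr0// (lt_le_trans c0).
have cc : - c <= c by rewrite ge0_cp.
have cn : {within `[- c, c], continuous (fun r => `|f r|)}.
  apply: continuous_subspaceT => r.
  by apply: (@continuous_comp _ _ _ f (fun u => `|u|)); [exact: cf|exact: norm_continuous].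
have [x _ Hx] := EVT_max cc cn.
exists `|f x| => r; have [rc|rc] := leP `|r| c.
  by apply: Hx; rewrite in_itv /= -ler_norml.
by rewrite f0// normr0.
Qed.

Lemma lipschitz_of_derive (f Df : R -> R) (K : R) :
  (forall r, is_derive r (1 : R) f (Df r)) -> (forall r, `|Df r| <= K) ->
  forall r r', `|f r - f r'| <= K * `|r - r'|.
Proof.
move=> df DfK.
have H (r r' : R) : r <= r' -> `|f r' - f r| <= K * `|r' - r|.
  move=> rr; have [|c _ ->] := MVT_segment rr (fun x _ => df x).
    by apply: continuous_subspaceT => x; exact: is_derive1_continuous (df x).
  by rewrite normrM ler_wpM2r.
move=> r r'; have [rr|/ltW rr] := leP r' r; first exact: H.
by rewrite distrC (distrC r); exact: H.
Qed.

Lemma derive_near_cst (f : R -> R) (Df r c : R) :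
  is_derive r (1 : R) f Df -> (\near r, f r = c) -> Df = 0.
Proof.
move=> [_ <-] fc; rewrite (@near_eq_derive _ _ _ f (cst c))//.
exact: derive_cst.
Qed.

(** Handles the radius [2 * eps] itself, where the profile of [psi] is known to be constant only on
    the right. *)
Lemma vanish_right_limit (f : R -> R) (a : R) : {for a, continuous f} ->
  (forall r, a < r -> f r = 0) -> f a = 0.
Proof.
move=> cf f0.
have H1 : f r @[r --> a^'+] --> f a by exact: cvg_at_right_filter.
have H2 : f r @[r --> a^'+] --> (0 : R).
  apply/cvg_rightP => e e0; exists 1 => // h /andP[h0 _].
  by rewrite f0 ?ltrDl// subrr normr0.
exact: (cvg_unique (@norm_hausdorff _ _) H1 H2).
Qed.

End profile.

Section radial_profile.
Context {R : realType} {d : nat}.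
Implicit Types (x : 'rV[R]_d) (f : 'rV[R]_d -> R).

Lemma line_continuous (x0 v : 'rV[R]_d) : continuous (fun r : R => x0 + r *: v).
Proof.
move=> r; apply: cvgD; first exact: cvg_cst.
exact: scalel_continuous.
Qed.

Lemma is_derive_line f x0 i (r : R) :
  derivable f (x0 + r *: delta_mx 0 i) (delta_mx 0 i) ->
  is_derive r (1 : R) (fun u => f (x0 + u *: delta_mx 0 i))
    (partial f i (x0 + r *: delta_mx 0 i)).
Proof.
move=> df; apply/is_derive_alongP.
have : is_derive (x0 + r *: delta_mx 0 i) (delta_mx 0 i) f
    (partial f i (x0 + r *: delta_mx 0 i)) by exact: DeriveDef.
move=> /is_derive_alongP; congr is_derive; apply/funext => h /=.
by rewrite [h *: 1]mulr1 addrCA -scalerDl.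
Qed.

Variables (x0 : 'rV[R]_d) (eps : R) (psi : 'rV[R]_d -> R).
Hypothesis d_gt0 : (0 < d)%N.
Hypothesis eps_gt0 : 0 < eps.
Hypothesis psi_smooth : smooth psi.
Hypothesis psi_radial : forall x y, enorm (x - x0) = enorm (y - x0) -> psi x = psi y.
Hypothesis psi_eq1 : forall x, closure (eball x0 eps) x -> psi x = 1.
Hypothesis psi_eq0 : forall x, closure (~` eball x0 (2 * eps)) x -> psi x = 0.

(** The profile [p] is [psi] read along a coordinate line through [x0], hence twice continuously
    differentiable. The derivative [2 * p1 r + r * p2 r] of [p r + r * p1 r] is continuous with
    compact support; its bound is the Lipschitz constant [K]. *)
Lemma radial_profile : exists p p1 : R -> R, exists B K : R,
  [/\ forall x, psi x = p (enorm (x - x0)),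
      continuous p1 /\ forall r, is_derive r (1 : R) p (p1 r),
      forall r, `|p1 r| <= B,
      forall r r', `|(p r + r * p1 r) - (p r' + r' * p1 r')| <= K * `|r - r'| &
      (forall r, 0 <= r < eps -> p r = 1 /\ p1 r = 0) /\
      (forall r, 2 * eps <= r -> p r = 0 /\ p1 r = 0)].
Proof.
pose i0 := Ordinal d_gt0.
pose e0 : 'rV[R]_d := delta_mx 0 i0.
have nline r : enorm (x0 + r *: e0 - x0) = `|r|.
  by rewrite addrAC subrr add0r enormZ enorm_delta mulr1.
pose p r := psi (x0 + r *: e0).
pose p1 r := partial psi i0 (x0 + r *: e0).
pose p2 r := partial (partial psi i0) i0 (x0 + r *: e0).
have cl (f : _ -> R) : continuous f -> continuous (fun r : R => f (x0 + r *: e0)).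
  move=> cf r; apply: (@continuous_comp _ _ _ (fun r : R => x0 + r *: e0) f).
    exact: line_continuous.
  exact: cf.
have cp : continuous p by apply: cl; exact: (psi_smooth [::]).1.
have cp1 : continuous p1 by apply: cl; exact: (psi_smooth [:: i0]).1.
have cp2 : continuous p2 by apply: cl; exact: (psi_smooth [:: i0; i0]).1.
have dp r : is_derive r (1 : R) p (p1 r).
  by apply: is_derive_line; exact: (psi_smooth [::]).2.
have dp1 r : is_derive r (1 : R) p1 (p2 r).
  by apply: is_derive_line; exact: (psi_smooth [:: i0]).2.
have p_one r : `|r| < eps -> p r = 1.
  by move=> re; apply: psi_eq1; apply: subset_closure; rewrite /eball /= nline.
have p_zero r : 2 * eps <= `|r| -> p r = 0.
  move=> re; apply: psi_eq0; apply: subset_closure; rewrite /eball /= nline.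
  by apply/negP; rewrite -leNgt.
have near_norm_lt (r c : R) : `|r| < c -> \near r, `|r| < c.
  by move=> rc; exact: (cvgr_lt _ (@norm_continuous _ R r) _ rc).
have near_norm_gt (r c : R) : c < `|r| -> \near r, c < `|r|.
  by move=> rc; exact: (cvgr_gt _ (@norm_continuous _ R r) _ rc).
have p1_one r : `|r| < eps -> p1 r = 0.
  move=> re; apply: (derive_near_cst (c := 1) (dp r)).
  by apply: filterS (near_norm_lt r _ re) => u; exact: p_one.
have p1_zero r : 2 * eps < `|r| -> p1 r = 0.
  move=> re; apply: (derive_near_cst (c := 0) (dp r)).
  by apply: filterS (near_norm_gt r _ re) => u /ltW; exact: p_zero.
have p2_zero r : 2 * eps < `|r| -> p2 r = 0.
  move=> re; apply: (derive_near_cst (c := 0) (dp1 r)).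
  by apply: filterS (near_norm_gt r _ re) => u; exact: p1_zero.
have e2 : 0 < 2 * eps by rewrite mulr_gt0.
have [B HB] := bounded_of_compact_support cp1 p1_zero.
have dh r : is_derive r (1 : R) (fun r : R => p r + r * p1 r) (2 * p1 r + r * p2 r).
  have := is_derive_addf (dp r) (is_derive_mulf (is_derive_id r (1 : R)) (dp1 r)).
  by move=> H; apply: (is_derive_eq H); ring.
have ch : continuous (fun r : R => 2 * p1 r + r * p2 r).
  move=> r; apply: cvgD; apply: cvgM; rewrite ?[X in _ --> X]/=;
    [exact: cvg_cst|exact: cp1|exact: cvg_id|exact: cp2].
have [K HK] : exists K, forall r, `|2 * p1 r + r * p2 r| <= K.
  apply: (bounded_of_compact_support (c := 2 * eps)) => // r re.
  by rewrite p1_zero// p2_zero// !mulr0 addr0.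
exists p, p1, B, K; split => //.
- by move=> x; apply: psi_radial; rewrite nline ger0_norm// enorm_ge0.
- exact: lipschitz_of_derive.
- split=> r.
    by move=> /andP[r0 re]; rewrite p_one ?p1_one// ger0_norm.
  move=> re; split; first by rewrite p_zero// ger0_norm// (le_trans (ltW e2)).
  move: re; rewrite le_eqVlt => /predU1P[<-|re].
    apply: (vanish_right_limit (cp1 _)) => u eu.
    by rewrite p1_zero// ger0_norm// ltW// (lt_trans e2).
  by rewrite p1_zero// ger0_norm// ltW// (lt_trans e2).
Qed.

End radial_profile.

(** * The flow in polar coordinates *)

Section radial_flow.
Context {R : realType} {d : nat}.
Implicit Types (x : 'rV[R]_d) (t r : R).

Lemma grad_radial (x0 : 'rV[R]_d) (psi : 'rV[R]_d -> R) (p p1 : R -> R) x :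
  (forall y, psi y = p (enorm (y - x0))) ->
  (forall r, is_derive r (1 : R) p (p1 r)) -> x != x0 ->
  grad (fun y => psi y * enorm (y - x0)) x =
    ((p (enorm (x - x0)) + enorm (x - x0) * p1 (enorm (x - x0))) / enorm (x - x0))
      *: (x - x0).
Proof.
move=> psiE dp xx0; apply/rowP => i; rewrite !mxE /partial.
have -> : (fun y => psi y * enorm (y - x0)) =
    (fun y => (fun r => p r * r) (enorm (y - x0))).
  by apply/funext => y; rewrite psiE.
have H := is_derive_comp_along (is_derive_mulf (dp _) (is_derive_id _ (1 : R)))
  (is_derive_enormB_delta i xx0).
by have [_ ->] := H; rewrite !mxE; ring.
Qed.

Variables (x0 : 'rV[R]_d) (eps K : R) (h : R -> R).
Variables (theta : 'rV[R]_d -> 'rV[R]_d) (Phi : R -> 'rV[R]_d -> 'rV[R]_d).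
Hypothesis d_gt0 : (0 < d)%N.
Hypothesis eps_gt0 : 0 < eps.
Hypothesis h_lip : forall r r', `|h r - h r'| <= K * `|r - r'|.
Hypothesis h_one : forall r, 0 < r < eps -> h r = 1.
Hypothesis h_zero : forall r, 2 * eps <= r -> h r = 0.
Hypothesis theta_radial : forall x, x != x0 ->
  theta x = (h (enorm (x - x0)) / enorm (x - x0)) *: (x - x0).
Hypothesis Phi_flow : flow_off x0 theta Phi.

Let radius x t := enorm (Phi t x - x0).

Lemma radius_right_continuous x : x != x0 ->
  radius x t @[t --> (0 : R)^'+] --> radius x 0.
Proof.
move=> xx0; have [P0 Pc _] := Phi_flow xx0.
rewrite /radius P0.
apply: (cvg_comp (fun t => Phi t x) (fun y => enorm (y - x0)) Pc).
exact: enormB_continuous.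
Qed.

Lemma radius_gt0 x t : x != x0 -> 0 <= t -> 0 < radius x t.
Proof.
move=> xx0; have [P0 _ Pd] := Phi_flow xx0.
rewrite le_eqVlt => /predU1P[<-|t0]; rewrite /radius enormB_gt0 ?P0//.
by have [] := Pd t t0.
Qed.

Lemma is_derive_flow_coord x t i : x != x0 -> 0 < t ->
  is_derive t (1 : R) (fun u => (Phi u x - x0) 0 i)
    (h (radius x t) / radius x t * (Phi t x - x0) 0 i).
Proof.
move=> xx0 t0; have [_ _ Pd] := Phi_flow xx0; have [Pt dPt] := Pd t t0.
have := is_derive_entry i dPt; rewrite theta_radial// mxE => H.
have := is_derive_addf H (is_derive_cst (- x0 0 i) t (1 : R)).
by rewrite addr0; congr is_derive; apply/funext => u; rewrite !mxE.
Qed.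

Lemma is_derive_radius x t : x != x0 -> 0 < t ->
  is_derive t (1 : R) (radius x) (h (radius x t)).
Proof.
move=> xx0 t0; have s0 := radius_gt0 xx0 (ltW t0).
have pos : 0 < \sum_i (Phi t x - x0) 0 i ^+ 2 by rewrite -sqr_enorm exprn_gt0.
apply: (is_derive_eq (is_derive_sqrt_sum_sqr
  (c := fun i u => (Phi u x - x0) 0 i) (fun i => is_derive_flow_coord i xx0 t0) pos)).
rewrite -/(enorm (Phi t x - x0)) -/(radius x t).
under eq_bigr do rewrite mulrCA -expr2.
rewrite -mulr_sumr -sqr_enorm -/(radius x t); field.
by rewrite gt_eqF.
Qed.

Lemma radius_trajectory x T : x != x0 -> trajectory h T (radius x).
Proof.
move=> xx0; split=> [|t /andP[t0 _]]; first exact: radius_right_continuous.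
exact: is_derive_radius.
Qed.

Lemma flow_radial x t : x != x0 -> 0 <= t ->
  Phi t x = x0 + (radius x t / enorm (x - x0)) *: (x - x0).
Proof.
move=> xx0; have [P0 Pc _] := Phi_flow xx0.
have xn : enorm (x - x0) != 0 by rewrite gt_eqF// enormB_gt0.
have r0 : radius x 0 = enorm (x - x0) by rewrite /radius P0.
rewrite le_eqVlt => /predU1P[<-|t0].
  by rewrite r0 divff// scale1r P0 addrC subrK.
(* Numerator and denominator have the same logarithmic rate [h / radius], so each coordinate of the
   unit direction has derivative 0. *)
have key i : (Phi t x - x0) 0 i / radius x t = (x - x0) 0 i / enorm (x - x0).
  pose u t := (Phi t x - x0) 0 i / radius x t.
  have du v : 0 < v <= t -> is_derive v (1 : R) u 0.
    move=> /andP[v0 _]; have s0 := radius_gt0 xx0 (ltW v0).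
    have dinv : is_derive v (1 : R) (fun v => (radius x v)^-1)
        (- (radius x v) ^- 2 *: h (radius x v)).
      by apply: is_deriveV; [rewrite gt_eqF|exact: is_derive_radius].
    apply: (is_derive_eq (is_derive_mulf (is_derive_flow_coord i xx0 v0) dinv)).
    rewrite /GRing.scale /=; field.
    by rewrite gt_eqF.
  have uc : u v @[v --> (0 : R)^'+] --> u 0.
    rewrite /u; apply: cvgM.
      rewrite P0; apply: (cvg_comp (fun t => Phi t x) (fun y => (y - x0) 0 i) Pc).
      have -> : (fun y : 'rV[R]_d => (y - x0) 0 i) = (fun y => y 0 i - x0 0 i).
        by apply/funext => y; rewrite !mxE.
      rewrite !mxE; apply: cvgB; [exact: coord_continuous|exact: cvg_cst].
    apply: cvgV; first by rewrite r0.
    exact: radius_right_continuous.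
  have [c _] := right_mean_value t0 uc du.
  by rewrite mul0r => /eqP; rewrite subr_eq0 => /eqP; rewrite /u r0 P0.
have s0 := radius_gt0 xx0 (ltW t0).
suff <- : Phi t x - x0 = (radius x t / enorm (x - x0)) *: (x - x0) by rewrite addrC subrK.
apply/rowP => i; rewrite [RHS]mxE -mulrA [_^-1 * _]mulrC -key.
by rewrite mulrCA divff ?mulr1// gt_eqF.
Qed.

(** Collects all that the support argument uses about the flow at time [t], in terms of the radius
    map [sigma] alone. *)
Lemma flow_map t : 0 <= t < eps -> exists sigma : R -> R,
  [/\ forall x, x != x0 ->
        Phi t x = x0 + (sigma (enorm (x - x0)) / enorm (x - x0)) *: (x - x0),
      forall r, 0 < r -> {for r, continuous sigma},
      forall r, 0 < r -> t < sigma r,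
      (forall r, 2 * eps <= r -> sigma r = r) /\
      (forall r, 0 < r < 2 * eps -> sigma r < 2 * eps) &
      forall r, t < r -> exists2 r', 0 < r' & sigma r' = r].
Proof.
move=> /[dup] /andP[t0 te] te'.
(* One fixed ray is enough to define [sigma]: by uniqueness the radius at time [t] depends only on
   the initial radius. *)
pose i0 := Ordinal d_gt0; pose ray r := x0 + r *: (delta_mx 0 i0 : 'rV[R]_d).
have rayn r : 0 < r -> enorm (ray r - x0) = r.
  by move=> r0; rewrite addrAC subrr add0r enormZ enorm_delta mulr1 gtr0_norm.
have ray0 r : 0 < r -> ray r != x0.
  by move=> r0; rewrite -enormB_gt0 rayn.
pose S t r := radius (ray r) t.
have S0 r : 0 < r -> S 0 r = r.
  by move=> r0; rewrite /S /radius; have [-> _ _] := Phi_flow (ray0 r r0); rewrite rayn.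
have ST T r : 0 < r -> trajectory h T (S^~ r).
  by move=> r0; exact: radius_trajectory (ray0 r r0).
exists (S t); split.
- move=> x xx0; rewrite flow_radial//; congr (x0 + (_ / _) *: _).
  have r0 : 0 < enorm (x - x0) by rewrite enormB_gt0.
  apply: (trajectory_eq h_lip t0 (radius_trajectory t xx0) (ST t _ r0)).
  by rewrite S0// /radius; have [-> _ _] := Phi_flow xx0.
- by move=> r r0; exact: (flow1_continuous h_lip S0 ST).
- by move=> r r0; exact: (flow1_gt h_lip h_one S0 ST).
- split=> r; first exact: (flow1_far h_lip eps_gt0 h_zero S0 ST).
  by move=> /andP[r0 re]; exact: (flow1_lt_far h_lip eps_gt0 h_zero S0 ST).
- move=> r tr; exact: (flow1_surjective h_lip eps_gt0 h_one h_zero S0 ST).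
Qed.

End radial_flow.

(** * Support of the transported measure *)

Section borel.
Context {R : realType} {d : nat}.
Implicit Types (x : 'rV[R]_d) (U : set 'rV[R]_d).

Lemma borel_open U : open U -> measurable (U : set (borelRd R d)).
Proof. by move=> oU; apply: sub_sigma_algebra. Qed.

Lemma borel_set1 x : measurable ([set x] : set (borelRd R d)).
Proof.
have -> : [set x] = ~` [set y | 0 < enorm (y - x)].
  apply/seteqP; split=> [y /= ->|y /= /negP]; first by rewrite enormB_gt0 eqxx.
  by rewrite enormB_gt0 negbK => /eqP.
by apply: measurableC; apply: borel_open; exact: open_enorm_gt.
Qed.

Lemma measurable_continuous_real (f : 'rV[R]_d -> R) : continuous f ->
  measurable_fun setT (f : borelRd R d -> R).
Proof.
move=> cf; apply: (measurability _ (measurable_realfun.RGenOpens.measurableE R)).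
move=> /= _ [_ [a [b ->]] <-]; rewrite setTI; apply: borel_open.
apply: open_comp => [x _|]; first exact: cf.
exact: interval_open.
Qed.

Lemma open_preimage_off x0 (F : 'rV[R]_d -> 'rV[R]_d) U :
  (forall x, x != x0 -> {for x, continuous F}) -> open U ->
  open [set x | x != x0 /\ U (F x)].
Proof.
move=> cF oU; rewrite openE => x /= [xx0 UFx]; apply: filterI.
  have : nbhs x [set y | 0 < enorm (y - x0)].
    by apply: open_nbhs_nbhs; split; [exact: open_enorm_gt|rewrite /= enormB_gt0].
  by apply: filterS => y /=; rewrite enormB_gt0.
by apply: (cF x xx0); apply: open_nbhs_nbhs; split.
Qed.

(** The arbitrary value at [x0] changes the preimage of an open set by at most one point, which is
    Borel. *)
Lemma measurable_continuous_off x0 (F : 'rV[R]_d -> 'rV[R]_d) :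
  (forall x, x != x0 -> {for x, continuous F}) ->
  measurable_fun setT (F : borelRd R d -> borelRd R d).
Proof.
move=> cF; apply: (@measurability _ _ (borelRd R d) (borelRd R d) setT F (@open 'rV[R]_d)) => //.
move=> _ [U oU <-]; rewrite setTI.
have -> : F @^-1` U = [set x | x != x0 /\ U (F x)] `|` ([set x0] `&` F @^-1` U).
  apply/seteqP; split=> x /=; last by move=> [[]|[]].
  by have [->|xx0] := eqVneq x x0; [right|left].
apply: measurableU; first by apply: borel_open; exact: open_preimage_off.
have [Ux0|Ux0] := pselect (U (F x0)).
  have -> : [set x0] `&` F @^-1` U = [set x0].
    by apply/seteqP; split=> x /=; [case|move=> ->].
  exact: borel_set1.
have -> : [set x0] `&` F @^-1` U = set0; last exact: measurable0.
by apply/seteqP; split=> x //= [->].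
Qed.

(** Makes a weak inequality between radii strict and at the same time avoids [p], in practice the
    image of a possible atom at [x0]. *)
Lemma outward_point x0 U z p : (0 < d)%N -> open U -> U z ->
  exists z', [/\ U z', z' != p & enorm (z - x0) < enorm (z' - x0)].
Proof.
move=> d_gt0 oU Uz.
(* At the centre every nonzero direction is outward. *)
pose v : 'rV[R]_d := if z == x0 then delta_mx 0 (Ordinal d_gt0) else z - x0.
have v0 : 0 < enorm v.
  by rewrite /v; case: eqVneq => [_|]; rewrite ?enorm_delta// enormB_gt0.
have vn (a : R) : 0 < a -> enorm (z - x0) < enorm (z + a *: v - x0).
  move=> a0; rewrite /v; case: eqVneq => [->|zx0].
    have /eqP-> : enorm (x0 - x0) == 0 by rewrite enorm_eq0 subrr.
    by rewrite addrAC subrr add0r enormZ enorm_delta mulr1 gtr0_norm.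
  have -> : z + a *: (z - x0) - x0 = (1 + a) *: (z - x0).
    by rewrite scalerDl scale1r addrAC.
  rewrite enormZ.
  by rewrite gtr0_norm ?addr_gt0// ltr_pMl ?enormB_gt0// ltrDl.
have : \forall a \near (0 : R)^'+, U (z + a *: v).
  have := cvg_at_right_filter (@line_continuous _ _ z v 0).
  by rewrite scale0r addr0; apply; apply: open_nbhs_nbhs.
move=> /near_rightP[D D0 HD].
have HDi (n : nat) : (1 < n)%N -> 0 < D / n%:R < D.
  by move=> n1; rewrite divr_gt0 ?ltr0n ?(ltn_trans _ n1)//= ltr_pdivrMr ?ltr0n ?(ltn_trans _ n1)//
    ltr_pMr// ltr1n.
(* The steps [D / 2] and [D / 3] give distinct points, so at most one of them is [p]. *)
have [zp|zp] := eqVneq (z + (D / 2%:R) *: v) p; last first.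
  exists (z + (D / 2%:R) *: v); split => //.
    by have := HD _ (HDi 2%N isT); rewrite add0r.
  by apply: vn; have /andP[] := HDi 2%N isT.
exists (z + (D / 3%:R) *: v); split.
- by have := HD _ (HDi 3%N isT); rewrite add0r.
- rewrite -zp (inj_eq (addrI _)) -subr_eq0 -scalerBl scaler_eq0 -enorm_eq0 (gt_eqF v0) orbF.
  by rewrite subr_eq0 (inj_eq (mulfI (lt0r_neq0 D0))) (inj_eq invr_inj) eqr_nat.
- by apply: vn; have /andP[] := HDi 3%N isT.
Qed.

End borel.

Section support_of_flow.
Context {R : realType} {d : nat}.
Implicit Types (x y z : 'rV[R]_d) (U : set 'rV[R]_d).

Lemma sqr_enormD_le x y : enorm (x + y) ^+ 2 <= 2 * enorm x ^+ 2 + 2 * enorm y ^+ 2.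
Proof.
rewrite !sqr_enorm !mulr_sumr -big_split /=; apply: ler_sum => i _; rewrite mxE.
rewrite -subr_ge0; set a := x 0 i; set b := y 0 i.
by have -> : 2 * a ^+ 2 + 2 * b ^+ 2 - (a + b) ^+ 2 = (a - b) ^+ 2; [ring|rewrite sqr_ge0].
Qed.

(** The base point [c] is kept apart from [x0]: the flow map has [c = x0], the field [theta] has
    [c = 0]. *)
Lemma radial_continuous (x0 c : 'rV[R]_d) (F : 'rV[R]_d -> 'rV[R]_d) (sigma : R -> R) :
  (forall x, x != x0 -> F x = c + (sigma (enorm (x - x0)) / enorm (x - x0)) *: (x - x0)) ->
  (forall r, 0 < r -> {for r, continuous sigma}) ->
  forall x, x != x0 -> {for x, continuous F}.
Proof.
move=> FE sigma_continuous x xx0; have r0 : 0 < enorm (x - x0) by rewrite enormB_gt0.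
rewrite /prop_for /continuous_at FE//.
have cB : y - x0 @[y --> x] --> x - x0.
  exact: (@continuousB _ _ _ id (cst x0) x (@cvg_id _ _) (@cst_continuous _ _ _ x)).
have c1 : enorm (y - x0) @[y --> x] --> enorm (x - x0) by exact: enormB_continuous.
have c2 : sigma (enorm (y - x0)) @[y --> x] --> sigma (enorm (x - x0)).
  exact: (cvg_comp (fun y => enorm (y - x0)) sigma c1 (sigma_continuous _ r0)).
have c3 : (enorm (y - x0))^-1 @[y --> x] --> (enorm (x - x0))^-1.
  by apply: cvgV c1; rewrite gt_eqF.
have cS : sigma (enorm (y - x0)) / enorm (y - x0) @[y --> x]
    --> sigma (enorm (x - x0)) / enorm (x - x0) by exact: (cvgM c2 c3).
have cG : c + (sigma (enorm (y - x0)) / enorm (y - x0)) *: (y - x0) @[y --> x]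
    --> c + (sigma (enorm (x - x0)) / enorm (x - x0)) *: (x - x0).
  exact: (cvgD (cvg_cst _) (cvgZ cS cB)).
apply: cvg_trans cG; apply: (@near_eq_cvg _ _ _ (nbhs_filter x)).
have : nbhs x [set y | 0 < enorm (y - x0)].
  by apply: open_nbhs_nbhs; split; [exact: open_enorm_gt|].
by move=> H; apply: filterS H => y /=; rewrite enormB_gt0 => /FE ->.
Qed.

Variables (mu : probability (borelRd R d) R) (x0 : 'rV[R]_d) (eps t : R).
Variables (F : 'rV[R]_d -> 'rV[R]_d) (sigma : R -> R).
Hypothesis d_gt0 : (0 < d)%N.
Hypothesis eps_gt0 : 0 < eps.
Hypothesis t_ge0 : 0 <= t.
Hypothesis FE : forall x, x != x0 ->
  F x = x0 + (sigma (enorm (x - x0)) / enorm (x - x0)) *: (x - x0).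
Hypothesis sigma_continuous : forall r, 0 < r -> {for r, continuous sigma}.
Hypothesis sigma_gt : forall r, 0 < r -> t < sigma r.
Hypothesis sigma_far : forall r, 2 * eps <= r -> sigma r = r.
Hypothesis sigma_near : forall r, 0 < r < 2 * eps -> sigma r < 2 * eps.
Hypothesis sigma_surj : forall r, t < r -> exists2 r', 0 < r' & sigma r' = r.

Lemma enorm_flow x : x != x0 -> enorm (F x - x0) = sigma (enorm (x - x0)).
Proof.
move=> xx0; have r0 : 0 < enorm (x - x0) by rewrite enormB_gt0.
rewrite FE// addrAC subrr add0r enormZ normrM normfV (gtr0_norm r0) divfK ?gt_eqF//.
by rewrite gtr0_norm// (le_lt_trans t_ge0) ?sigma_gt.
Qed.

Lemma flow_far x : 2 * eps <= enorm (x - x0) -> F x = x.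
Proof.
move=> re; have r0 : 0 < enorm (x - x0) by rewrite (lt_le_trans _ re)// mulr_gt0.
by rewrite FE -?enormB_gt0// sigma_far// divff ?gt_eqF// scale1r addrC subrK.
Qed.

Lemma flow_near x : x != x0 -> enorm (x - x0) < 2 * eps -> enorm (F x - x0) < 2 * eps.
Proof. by move=> xx0 re; rewrite enorm_flow// sigma_near// enormB_gt0 xx0. Qed.

(** Old and new radius lie on the same ray and both below [2 * eps], unless the point is fixed; the
    second summand absorbs the arbitrary value at [x0]. *)
Lemma flow_displacement x :
  enorm (F x - x) ^+ 2 <= (2 * eps) ^+ 2 + enorm (F x0 - x0) ^+ 2.
Proof.
have [->|xx0] := eqVneq x x0; first by rewrite lerDr sqr_ge0.
apply: ler_wpDr; first exact: sqr_ge0.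
have [re|re] := leP (2 * eps) (enorm (x - x0)).
  have /eqP-> : enorm (F x - x) == 0 by rewrite enorm_eq0 subr_eq0 flow_far.
  by rewrite expr0n sqr_ge0.
have r0 : 0 < enorm (x - x0) by rewrite enormB_gt0.
have s0 : 0 < sigma (enorm (x - x0)) by exact: le_lt_trans (sigma_gt r0).
have s2 : sigma (enorm (x - x0)) < 2 * eps by rewrite sigma_near// r0.
have -> : F x - x = (sigma (enorm (x - x0)) / enorm (x - x0) - 1) *: (x - x0).
  by rewrite FE// scalerBl scale1r opprB addrCA addrA.
rewrite enormZ -[X in _ * X](gtr0_norm r0) -normrM mulrBl mul1r divfK ?gt_eqF//.
rewrite real_normK ?num_real// -[leLHS]real_normK ?num_real// lerXn2r// ?nnegrE ?mulr_ge0 ?ltW//.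
by rewrite ltr_norml; apply/andP; split; lra.
Qed.

Lemma flow_surj z : t < enorm (z - x0) -> exists2 x, x != x0 & F x = z.
Proof.
move=> tz; have [r r0 sr] := sigma_surj tz.
have z0 : 0 < enorm (z - x0) by exact: le_lt_trans tz.
have xn : enorm (x0 + (r / enorm (z - x0)) *: (z - x0) - x0) = r.
  by rewrite addrAC subrr add0r enormZ normrM normfV (gtr0_norm r0) (gtr0_norm z0)
    divfK ?gt_eqF.
have xx0 : x0 + (r / enorm (z - x0)) *: (z - x0) != x0 by rewrite -enormB_gt0 xn.
exists (x0 + (r / enorm (z - x0)) *: (z - x0)) => //.
rewrite FE// xn sr [X in _ *: X]addrAC subrr add0r scalerA.
by rewrite mulrA divfK ?gt_eqF// divff ?gt_eqF// scale1r addrC subrK.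
Qed.

Lemma flow_continuous x : x != x0 -> {for x, continuous F}.
Proof. exact: (radial_continuous FE sigma_continuous). Qed.

Lemma flow_measurable : measurable_fun setT (F : borelRd R d -> borelRd R d).
Proof. exact: measurable_continuous_off flow_continuous. Qed.

Let nu := pushforward mu (F : borelRd R d -> borelRd R d).

Lemma nu_gt0_sub U (A : set 'rV[R]_d) : open U -> measurable (A : set (borelRd R d)) ->
  F @^-1` U `<=` A -> (0 < nu U)%E -> (0 < mu A)%E.
Proof.
move=> oU mA UA nuU; apply: lt_le_trans nuU _.
rewrite /nu /pushforward; apply: le_measure; rewrite ?inE//.
by have := flow_measurable measurableT (borel_open oU); rewrite setTI.
Qed.

Hypothesis eps_supp : closure (eball x0 (2 * eps)) `<=` supp_int mu.

(* The case t = 0, y = x0 forces the detour through the outward point z: the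
   flow does not reach x0, and its value at x0 is arbitrary. *)
Lemma perforate_sub_supp : perforate (supp_int mu) x0 t `<=` supp nu.
Proof.
move=> y [/= Sy Ny] U oU Uy.
have ty : t <= enorm (y - x0).
  by rewrite leNgt; apply/negP => yt; apply: Ny; exact: subset_closure.
have [z [[Uz Sz] _ yz]] := outward_point x0 y d_gt0
  (openI oU (@open_interior _ (supp mu))) (conj Uy Sy).
have tz : t < enorm (z - x0) := le_lt_trans ty yz.
have [x xx0 Fxz] := flow_surj tz.
(* A far preimage equals [z] itself, which lies in the support; a near one lies in the ball
   contained in [supp_int mu]. *)
have Sx : supp mu x.
  have [re|re] := leP (2 * eps) (enorm (x - x0)).
    by apply: interior_subset; rewrite -(flow_far re) Fxz.
  by apply: interior_subset; apply: eps_supp; exact: subset_closure.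
have oA := open_preimage_off flow_continuous oU.
have : (0 < mu [set x | x != x0 /\ U (F x)])%E.
  by apply: Sx oA _; rewrite /= Fxz.
move=> /lt_le_trans; apply; apply: le_measure; rewrite ?inE//.
- exact: borel_open.
- by have := flow_measurable measurableT (borel_open oU); rewrite setTI.
- by move=> u [].
Qed.

Lemma supp_sub_perforate : supp_int nu `<=` perforate (supp_int mu) x0 t.
Proof.
have oW := @open_interior _ (supp nu); move=> y Wy.
(* The open [t]-ball without the point [F x0] has empty preimage; a support point interior to the
   support and inside the ball could be moved off [F x0] and would contradict this. *)
have W_out z : supp_int nu z -> t <= enorm (z - x0).
  move=> Wz; rewrite leNgt; apply/negP => zt.
  have [z' [[Wz' z't] z'p _]] := outward_point x0 (F x0) d_gt0
    (openI oW (@open_enorm_lt _ _ x0 t)) (conj Wz zt).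
  have oU := openI (@open_enorm_lt _ _ x0 t) (@open_enorm_gt _ _ (F x0) 0).
  have Uz' : ([set x | enorm (x - x0) < t] `&` [set x | 0 < enorm (x - F x0)]) z'.
    by split; rewrite //= enormB_gt0.
  have := (interior_subset Wz' : supp nu z') _ oU Uz'; rewrite ltNge => /negP; apply.
  rewrite /nu /pushforward (_ : _ @^-1` _ = set0) ?measure0//.
  apply/seteqP; split=> // x /= [xt xp].
  have [xx0|xx0] := eqVneq x x0; first by move: xp; rewrite xx0 enormB_gt0 eqxx.
  by move: xt; rewrite enorm_flow// ltNge ltW// sigma_gt// enormB_gt0.
split.
  suff : supp_int nu `<=` supp mu by rewrite open_subsetE//; exact.
  move=> z Wz.
  have [re|re] := ltP (enorm (z - x0)) (2 * eps).
    by apply: interior_subset; apply: eps_supp; exact: subset_closure.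
  move=> U oU Uz.
  have [z' [[Wz' Uz'] z'p zz']] := outward_point x0 (F x0) d_gt0 (openI oW oU) (conj Wz Uz).
  (* Cutting [U] down to radii beyond [2 * eps] and removing [F x0] leaves only preimages where the
     flow is the identity, so they lie in [U]. *)
  have oV := openI (openI oU (@open_enorm_gt _ _ x0 (2 * eps))) (@open_enorm_gt _ _ (F x0) 0).
  apply: nu_gt0_sub oV (borel_open oU) _ ((interior_subset Wz' : supp nu z') _ oV _).
    move=> x /= [[Ux ex] xp].
    have xx0 : x != x0 by apply/eqP => xx0; move: xp; rewrite xx0 enormB_gt0 eqxx.
    have [rx|rx] := leP (2 * eps) (enorm (x - x0)).
      by move: Ux; rewrite flow_far.
    by move: ex; rewrite ltNge ltW// flow_near.
  by split; [split=> //=; exact: le_lt_trans zz'|rewrite /= enormB_gt0].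
(* If [y] were in the closed ball, the open set [supp_int nu] would meet the open ball, against
   [W_out]. *)
move=> /(_ _ (open_nbhs_nbhs (conj oW Wy))) [z [/= zt Wz]].
by have := W_out z Wz; rewrite leNgt zt.
Qed.

Lemma supp_int_flow : supp_int nu = perforate (supp_int mu) x0 t.
Proof.
apply/seteqP; split; first exact: supp_sub_perforate.
rewrite /supp_int -[X in X `<=` _]/(perforate (supp_int mu) x0 t).
have oP : open (perforate (supp_int mu) x0 t).
  apply: openI; first exact: open_interior.
  by apply: closed_openC; exact: closed_closure.
by rewrite -open_subsetE//; exact: perforate_sub_supp.
Qed.

End support_of_flow.

(** * Finite second moment of the transported measure *)

Section second_moment.
Context {R : realType} {d : nat}.

Lemma measurable_sqr_enorm (F : borelRd R d -> borelRd R d) : measurable_fun setT F ->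
  @measurable_fun _ _ (borelRd R d) (\bar R) setT (fun x => (enorm (F x) ^+ 2)%:E).
Proof.
move=> mF; apply/measurable_EFinP; apply: measurable_funX.
apply: measurableT_comp mF; apply: measurable_continuous_real.
exact: enorm_continuous.
Qed.

(** Bounded displacement gives [|F x|^2 <= 2 C + 2 |x|^2], which is integrable for a probability
    measure in [P2]. *)
Lemma pushforward_P2 (mu : probability (borelRd R d) R) (F : borelRd R d -> borelRd R d)
    (C : R) : P2 mu -> measurable_fun setT F ->
  (forall x, enorm (F x - x) ^+ 2 <= C) ->
  exists2 P : probability (borelRd R d) R, P2 P & pushforward mu F = P.
Proof.
move=> muP mF FC.
pose mF_mixin := isMeasurableFun.Build _ _ _ _ _ mF.
pose X : {mfun borelRd R d >-> borelRd R d} := HB.pack F mF_mixin.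
exists (distribution mu X) => //.
have C0 : 0 <= C by apply: le_trans (FC 0); exact: sqr_ge0.
have mid : @measurable_fun _ _ (borelRd R d) (\bar R) setT (fun x => (enorm x ^+ 2)%:E).
  exact: (measurable_sqr_enorm (@measurable_id _ _ _)).
rewrite /P2 /= /distribution ge0_integral_pushforward//; last first.
  by move=> y _; rewrite lee_fin sqr_ge0.
rewrite preimage_setT.
apply: (@le_lt_trans _ _ (\int[mu]_x ((2 * C)%:E + 2%:E * (enorm x ^+ 2)%:E))%E).
  apply: ge0_le_integral => //.
  - by move=> x _; rewrite lee_fin sqr_ge0.
  - exact: measurable_sqr_enorm.
  - by apply: emeasurable_funD => //; apply: measurable_funeM.
  - move=> x _; rewrite -EFinM -EFinD lee_fin /= -[X in enorm X](subrK x).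
    by apply: le_trans (sqr_enormD_le _ _) _; rewrite lerD2r ler_wpM2l.
rewrite ge0_integralD//; last 3 first.
- by move=> x _; rewrite lee_fin mulr_ge0.
- by move=> x _; rewrite mule_ge0 ?lee_fin ?sqr_ge0.
- by apply: measurable_funeM.
rewrite ge0_integralZl//; last by move=> x _; rewrite lee_fin sqr_ge0.
rewrite integral_cst// lte_add_pinfty ?lte_mul_pinfty//.
  by rewrite lee_fin mulr_ge0.
exact: le_lt_trans (probability_le1 mu measurableT) (ltry 1).
Qed.

End second_moment.

(** * Approximation by gradients of test functions *)

Section smoothness.
Context {R : realType} {d : nat}.
Implicit Types (f g : 'rV[R]_d -> R) (x : 'rV[R]_d) (i : 'I_d).

(** Recursion on the order allows closure under sums and products to be proved by induction; all
    orders together give [smooth]. *)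
Fixpoint Ck (n : nat) f : Prop :=
  if n is m.+1 then continuous f /\
    forall i, (forall x, derivable f x (delta_mx 0 i)) /\ Ck m (partial f i)
  else continuous f.

Lemma smoothP f : smooth f <-> forall n, Ck n f.
Proof.
split=> [sf n|]; last first.
  move=> Cf s; elim: s f Cf => [|i s IH] f Cf /=.
    have [cf df] := Cf 1%N; split=> // x i; exact: (df i).1.
  by apply: IH => n; have [_ /(_ i)[]] := Cf n.+1.
elim: n f sf => [|n IH] f sf /=; first exact: (sf [::]).1.
split; first exact: (sf [::]).1.
move=> i; split; first by move=> x; exact: (sf [::]).2.
by apply: IH => s; exact: (sf (i :: s)).
Qed.

Lemma CkW n f : Ck n.+1 f -> Ck n f.
Proof.
elim: n f => [|n IH] f; first by case.
move=> [cf df]; split=> // i; have [di Ci] := df i; split=> //.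
exact: IH.
Qed.

Lemma partialE f (D : 'I_d -> 'rV[R]_d -> R) :
  (forall i x, is_derive x (delta_mx 0 i) f (D i x)) -> forall i, partial f i = D i.
Proof. by move=> fD i; apply/funext => x; have [_] := fD i x. Qed.

Lemma CkS n f (D : 'I_d -> 'rV[R]_d -> R) : continuous f ->
  (forall i x, is_derive x (delta_mx 0 i) f (D i x)) -> (forall i, Ck n (D i)) ->
  Ck n.+1 f.
Proof.
by move=> cf fD CD; split=> // i; rewrite (partialE fD).
Qed.

Lemma Ck_is_derive n f i x : Ck n.+1 f -> is_derive x (delta_mx 0 i) f (partial f i x).
Proof. by move=> [_ /(_ i)[df _]]; exact: DeriveDef. Qed.

Lemma Ck_cst n (c : R) : Ck n (fun _ => c).
Proof.
elim: n c => [|n IH] c; first exact: cst_continuous.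
apply: (@CkS n _ (fun _ _ => 0)) => //.
exact: cst_continuous.
Qed.

Lemma Ck_coord n j : Ck n (fun x => x 0 j).
Proof.
case: n => [|n]; first exact: coord_continuous.
apply: (@CkS n _ (fun i _ => (delta_mx 0 i : 'rV[R]_d) 0 j)) => [|i x|i].
- exact: coord_continuous.
- exact: is_derive_coord.
- exact: Ck_cst.
Qed.

Lemma CkD n f g : Ck n f -> Ck n g -> Ck n (fun x => f x + g x).
Proof.
have cD (f1 g1 : 'rV[R]_d -> R) : continuous f1 -> continuous g1 ->
    continuous (fun x => f1 x + g1 x).
  by move=> cf cg x; exact: (cvgD (cf x) (cg x)).
elim: n f g => [|n IH] f g; first exact: cD.
move=> Cf Cg; apply: (@CkS n _ (fun i x => partial f i x + partial g i x)) => [|i x|i].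
- by apply: cD; [exact: Cf.1|exact: Cg.1].
- exact: (is_derive_addf (Ck_is_derive i x Cf) (Ck_is_derive i x Cg)).
- by apply: IH; [exact: (Cf.2 i).2|exact: (Cg.2 i).2].
Qed.

Lemma CkM n f g : Ck n f -> Ck n g -> Ck n (fun x => f x * g x).
Proof.
have cM (f1 g1 : 'rV[R]_d -> R) : continuous f1 -> continuous g1 ->
    continuous (fun x => f1 x * g1 x).
  by move=> cf cg x; exact: (cvgM (cf x) (cg x)).
elim: n f g => [|n IH] f g; first exact: cM.
move=> Cf Cg; apply: (@CkS n _ (fun i x => partial f i x * g x + f x * partial g i x)) => [|i x|i].
- by apply: cM; [exact: Cf.1|exact: Cg.1].
- exact: (is_derive_mulf (Ck_is_derive i x Cf) (Ck_is_derive i x Cg)).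
- apply: CkD; apply: IH; [exact: (Cf.2 i).2|exact: CkW|exact: CkW|exact: (Cg.2 i).2].
Qed.

Lemma Ck_sum n m (F : 'I_m -> 'rV[R]_d -> R) : (forall j, Ck n (F j)) ->
  Ck n (fun x => \sum_j F j x).
Proof.
elim: m F => [|m IH] F CF.
  have -> : (fun x => \sum_(j < 0) F j x) = (fun _ => 0).
    by apply/funext => x; rewrite big_ord0.
  exact: Ck_cst.
have -> : (fun x => \sum_(j < m.+1) F j x) =
    (fun x => (\sum_(j < m) F (widen_ord (leqnSn m) j) x) + F ord_max x).
  by apply/funext => x; rewrite big_ord_recr.
by apply: CkD => //; exact: IH.
Qed.

End smoothness.

Section regularized_norm.
Context {R : realType} {d : nat}.
Variables (x0 v : 'rV[R]_d) (D : R).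
Hypothesis D_gt0 : 0 < D.
Implicit Types (x : 'rV[R]_d) (i : 'I_d).

(** Spelled out in sums and products so that [CkD], [CkM] and the derivative rules apply literally;
    [regsqE] gives the meaning. *)
Definition regsq x : R := (\sum_j (x 0 j + - x0 0 j) * (x 0 j + - x0 0 j)) + D ^+ 2.
Definition reginv x : R := (Num.sqrt (regsq x))^-1.
Definition reglin x : R := \sum_j v 0 j * (x 0 j + - x0 0 j).

(* A regularization of [|x - x0|] whose gradient tends to the unit radial field
   off [x0] and equals [v] at [x0]. *)
Definition regnorm x : R :=
  regsq x * reginv x + D ^+ 2 * (reginv x * reginv x * reglin x).

Lemma regsqE x : regsq x = enorm (x - x0) ^+ 2 + D ^+ 2.
Proof.
by rewrite sqr_enorm /regsq; congr (_ + _); apply: eq_bigr => j _; rewrite !mxE expr2.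
Qed.

Lemma regsq_gt0 x : 0 < regsq x.
Proof. by rewrite regsqE ltr_wpDl ?sqr_ge0 ?exprn_gt0. Qed.

Lemma reginv_gt0 x : 0 < reginv x.
Proof. by rewrite invr_gt0 sqrtr_gt0 regsq_gt0. Qed.

Lemma reginv_sqr x : reginv x ^+ 2 * (enorm (x - x0) ^+ 2 + D ^+ 2) = 1.
Proof.
by rewrite -regsqE /reginv exprVn sqr_sqrtr ?ltW ?regsq_gt0// mulVf// gt_eqF ?regsq_gt0.
Qed.

Lemma Ck_shift n j : Ck n (fun x : 'rV[R]_d => x 0 j + - x0 0 j).
Proof. by apply: CkD; [exact: Ck_coord|exact: Ck_cst]. Qed.

Lemma is_derive_shift x i j : is_derive x (delta_mx 0 i)
  (fun x : 'rV[R]_d => x 0 j + - x0 0 j) (i == j)%:R.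
Proof.
have := is_derive_addf (is_derive_coord x (delta_mx 0 i) j)
  (is_derive_cst (- x0 0 j) x (delta_mx 0 i)).
by rewrite mxE eqxx /= addr0 eq_sym.
Qed.

Lemma Ck_regsq n : Ck n regsq.
Proof.
apply: CkD; last exact: Ck_cst.
by apply: Ck_sum => j; apply: CkM; exact: Ck_shift.
Qed.

Lemma Ck_reglin n : Ck n reglin.
Proof. by apply: Ck_sum => j; apply: CkM; [exact: Ck_cst|exact: Ck_shift]. Qed.

Lemma is_derive_regsq x i :
  is_derive x (delta_mx 0 i) regsq (2 * (x 0 i + - x0 0 i)).
Proof.
have H := is_derive_addf (is_derive_sumf (fun j => is_derive_mulf
  (is_derive_shift x i j) (is_derive_shift x i j))) (is_derive_cst (D ^+ 2) x (delta_mx 0 i)).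
apply: (is_derive_eq H); rewrite addr0 (bigD1 i)//= big1 => [|j ji].
  by rewrite eqxx /=; ring.
by rewrite eq_sym (negPf ji) mul0r mulr0 addr0.
Qed.

Lemma is_derive_reglin x i : is_derive x (delta_mx 0 i) reglin (v 0 i).
Proof.
have H := is_derive_sumf (fun j => is_derive_mulf
  (is_derive_cst (v 0 j) x (delta_mx 0 i)) (is_derive_shift x i j)).
apply: (is_derive_eq H); rewrite (bigD1 i)//= big1 => [|j ji].
  by rewrite eqxx /=; ring.
by rewrite eq_sym (negPf ji) mul0r mulr0 addr0.
Qed.

Lemma is_derive_reginv x i : is_derive x (delta_mx 0 i) reginv
  (- 1 * (x 0 i + - x0 0 i) * (reginv x * (reginv x * reginv x))).
Proof.
have w0 := regsq_gt0 x.
have q0 : Num.sqrt (regsq x) != 0 by rewrite gt_eqF// sqrtr_gt0.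
have dinv : is_derive (Num.sqrt (regsq x)) (1 : R) (fun r : R => r^-1)
    (- (Num.sqrt (regsq x)) ^- 2 *: 1).
  by apply: (is_deriveV (f := id)) => //; exact: is_derive_id.
have dq := is_derive_comp_along (is_derive1_sqrt w0) (is_derive_regsq x i).
have H := is_derive_comp_along (f := fun y => Num.sqrt (regsq y)) dinv dq.
apply: (is_derive_eq H); rewrite /reginv /GRing.scale /=; field.
by rewrite q0.
Qed.

(** The partial derivatives are products of shifted coordinates and of [reginv] itself, so the
    induction on the order closes. *)
Lemma Ck_reginv n : Ck n reginv.
Proof.
have c0 : continuous reginv.
  move=> x.
  have c1 : Num.sqrt (regsq y) @[y --> x] --> Num.sqrt (regsq x).
    exact: (cvg_comp regsq Num.sqrt (Ck_regsq 0 x) (@sqrt_continuous _ _)).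
  by apply: cvgV c1; rewrite gt_eqF// sqrtr_gt0 regsq_gt0.
elim: n => // n IH; apply: (CkS c0 (fun i x => is_derive_reginv x i)) => i.
apply: CkM; last by do 2 (apply: CkM => //).
by apply: CkM; [exact: Ck_cst|exact: Ck_shift].
Qed.

Lemma Ck_regnorm n : Ck n regnorm.
Proof.
have Ci := Ck_reginv n; have Cs := Ck_regsq n; have Cl := Ck_reglin n.
apply: CkD; first exact: CkM.
by apply: CkM; [exact: Ck_cst|do 2 (apply: CkM => //)].
Qed.

(** The summand [regsq x * reginv x] is the square root of [regsq x]; the relation
    [regsq x * reginv x ^+ 2 = 1] collapses its product rule to one term. *)
Lemma is_derive_regnorm x i : is_derive x (delta_mx 0 i) regnorm
  ((x - x0) 0 i * reginv x + D ^+ 2 * (reginv x ^+ 2 * v 0 i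
    - 2 * (x - x0) 0 i * reginv x ^+ 4 * reglin x)).
Proof.
have di := is_derive_reginv x i; have dl := is_derive_reglin x i.
have H := is_derive_addf (is_derive_mulf (is_derive_regsq x i) di)
  (is_derive_mulf (is_derive_cst (D ^+ 2) x (delta_mx 0 i))
    (is_derive_mulf (is_derive_mulf di di) dl)).
apply: (is_derive_eq H); rewrite !mxE; set k := reginv x; set y := x 0 i - x0 0 i.
have k2 : regsq x * k ^+ 2 = 1 by rewrite mulrC regsqE reginv_sqr.
rewrite mul0r add0r.
have -> : 2 * y * k + regsq x * (-1 * y * (k * (k * k))) =
    2 * y * k - (regsq x * k ^+ 2) * y * k by ring.
by rewrite k2 /=; ring.
Qed.

End regularized_norm.

Lemma le_norm_mul {R : realDomainType} (a b A B : R) :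
  `|a| <= A -> `|b| <= B -> `|a * b| <= A * B.
Proof. by move=> aA bB; rewrite normrM ler_pM. Qed.

Lemma le_norm_add {R : realDomainType} (a b A B : R) :
  `|a| <= A -> `|b| <= B -> `|a + b| <= A + B.
Proof. by move=> aA bB; rewrite (le_trans (ler_normD _ _))// lerD. Qed.

(* With sigma = s k and eta = D k one has sigma^2 + eta^2 = 1, and the four
   contributions to the error are bounded by B D, B V D, eta, and 3 V eta. *)
Lemma regularized_gradient_error {R : realType} (s D k a P y l v V B : R) :
  0 < s -> 0 < D -> 0 < k -> k ^+ 2 * (s ^+ 2 + D ^+ 2) = 1 ->
  `|y| <= s -> `|l| <= V * s -> `|v| <= V -> `|a| <= B -> 0 <= P <= 1 ->
  `|a * ((s ^+ 2 + D ^+ 2) * k + D ^+ 2 * (k * k * l))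
    + P * (y * k + D ^+ 2 * (k ^+ 2 * v - 2 * y * k ^+ 4 * l))
    - (a * s + P * (y / s))| <= B * (D * (1 + V)) + D * k * (1 + 3 * V).
Proof.
move=> s0 D0 k0 k2 ys ls vV aB /andP[P0 P1].
have V0 : 0 <= V by apply: le_trans vV.
have s'0 := ltW s0; have D'0 := ltW D0; have k'0 := ltW k0.
have sk0 : 0 <= s * k by rewrite mulr_ge0.
have Dk0 : 0 <= D * k by rewrite mulr_ge0.
have skDk : (s * k) ^+ 2 + (D * k) ^+ 2 = 1 by rewrite -k2; ring.
have sk1 : s * k <= 1.
  by rewrite -(@ler_pXn2r _ 2)// ?nnegrE// expr1n -skDk lerDl sqr_ge0.
have Dk1 : D * k <= 1.
  by rewrite -(@ler_pXn2r _ 2)// ?nnegrE// expr1n -skDk lerDr sqr_ge0.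
have skDk1 : 1 <= s * k + D * k.
  rewrite -(@ler_pXn2r _ 2)// ?nnegrE ?addr_ge0// expr1n.
  have -> : (s * k + D * k) ^+ 2 =
    ((s * k) ^+ 2 + (D * k) ^+ 2) + 2 * (s * k * (D * k)) by ring.
  by rewrite skDk lerDl !mulr_ge0.
have Dk2 : (D * k) ^+ 2 <= D * k by rewrite expr2 ler_piMr.
(* The left term is the square root of [s^2 + D^2], so it lies between [s] and [s + D]; both bounds
   are checked after multiplication by [k]. *)
have e1 : `|(s ^+ 2 + D ^+ 2) * k - s| <= D.
  have qk : (s ^+ 2 + D ^+ 2) * k * k = 1 by rewrite -k2; ring.
  have lo : s <= (s ^+ 2 + D ^+ 2) * k by rewrite -(ler_pM2r k0) qk.
  have hi : (s ^+ 2 + D ^+ 2) * k <= s + D by rewrite -(ler_pM2r k0) qk mulrDl.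
  by rewrite ler_norml; apply/andP; split; lra.
have e2 : `|D ^+ 2 * (k * k * l)| <= D * V.
  have -> : D ^+ 2 * (k * k * l) = (D * k) ^+ 2 * l by ring.
  apply: le_trans (le_norm_mul (lexx _) ls) _.
  rewrite ger0_norm ?sqr_ge0//.
  have -> : (D * k) ^+ 2 * (V * s) = D * (V * ((D * k) * (s * k))) by ring.
  by rewrite ler_pM2l// ler_piMr// mulr_ile1.
have e3 : `|y * k - y / s| <= D * k.
  have -> : y * k - y / s = (y / s) * (s * k - 1).
    by field; rewrite gt_eqF.
  have ys1 : `|y / s| <= 1.
    by rewrite normrM normfV (gtr0_norm s0) ler_pdivrMr// mul1r.
  have sk : `|s * k - 1| <= D * k by rewrite ler_norml; apply/andP; split; lra.
  by rewrite -[leRHS]mul1r le_norm_mul.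
have e4 : `|D ^+ 2 * (k ^+ 2 * v)| <= D * k * V.
  have -> : D ^+ 2 * (k ^+ 2 * v) = (D * k) ^+ 2 * v by ring.
  by apply: le_norm_mul => //; rewrite ger0_norm ?sqr_ge0.
have e5 : `|D ^+ 2 * (2 * y * k ^+ 4 * l)| <= 2 * (D * k * V).
  have -> : D ^+ 2 * (2 * y * k ^+ 4 * l) = 2 * ((D * k) ^+ 2 * (k ^+ 2 * (y * l))) by ring.
  rewrite normrM ger0_norm// ler_pM2l//.
  apply: le_norm_mul; first by rewrite ger0_norm ?sqr_ge0.
  rewrite normrM ger0_norm ?sqr_ge0//.
  apply: (@le_trans _ _ (k ^+ 2 * (s * (V * s)))).
    by rewrite ler_wpM2l ?sqr_ge0// le_norm_mul.
  have -> : k ^+ 2 * (s * (V * s)) = V * (s * k) ^+ 2 by ring.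
  by rewrite ler_piMr// expr_le1.
have -> : a * ((s ^+ 2 + D ^+ 2) * k + D ^+ 2 * (k * k * l))
    + P * (y * k + D ^+ 2 * (k ^+ 2 * v - 2 * y * k ^+ 4 * l))
    - (a * s + P * (y / s)) =
  a * (((s ^+ 2 + D ^+ 2) * k - s) + D ^+ 2 * (k * k * l)) +
  P * ((y * k - y / s) + (D ^+ 2 * (k ^+ 2 * v) + - (D ^+ 2 * (2 * y * k ^+ 4 * l)))).
  by ring.
apply: le_norm_add.
  apply: le_norm_mul => //; rewrite mulrDr mulr1.
  exact: le_norm_add.
have -> : D * k * (1 + 3 * V) = 1 * (D * k + (D * k * V + 2 * (D * k * V))) by ring.
apply: le_norm_mul; first by rewrite ger0_norm.
apply: le_norm_add => //; apply: le_norm_add => //.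
by rewrite normrN.
Qed.

Section approximate_potential.
Context {R : realType} {d : nat}.
Variables (x0 : 'rV[R]_d) (eps B : R) (psi : 'rV[R]_d -> R).
Variable theta : 'rV[R]_d -> 'rV[R]_d.
Hypothesis eps_gt0 : 0 < eps.
Hypothesis psi_test : test_function psi.
Hypothesis psi_eq1 : forall x, closure (eball x0 eps) x -> psi x = 1.
Hypothesis psi_01 : forall x, 0 <= psi x <= 1.
Hypothesis psi_B : forall x i, x != x0 -> `|partial psi i x| <= B.
Hypothesis thetaE : forall x, x != x0 ->
  theta x = grad (fun y => psi y * enorm (y - x0)) x.
Implicit Types (x : 'rV[R]_d) (i : 'I_d).

(** This sum bounds every coordinate of [theta x0] and, times the distance to [x0], the linear term
    [reglin]. *)
Let V : R := \sum_i `|theta x0 0 i|.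

Lemma psi_derive x i : is_derive x (delta_mx 0 i) psi (partial psi i x).
Proof. by apply: DeriveDef => //; exact: (psi_test.1 [::]).2. Qed.

Lemma theta_coord x i : x != x0 -> theta x 0 i =
  partial psi i x * enorm (x - x0) + psi x * ((x - x0) 0 i / enorm (x - x0)).
Proof.
move=> xx0; rewrite thetaE// mxE.
by have [_] := is_derive_mulf (psi_derive x i) (is_derive_enormB_delta i xx0).
Qed.

Lemma test_function_mul g : (forall n, Ck n g) -> test_function (fun x => psi x * g x).
Proof.
move=> Cg; have [sp cp] := psi_test; split.
  by apply/smoothP => n; apply: CkM => //; exact: (smoothP psi).1.
apply: (subclosed_compact (@closed_closure _ _) cp).
by apply: closure_subset => x /=; apply: contra_neq => ->; rewrite mul0r.
Qed.

Lemma partial_psi_center i : partial psi i x0 = 0.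
Proof.
rewrite /partial (@near_eq_derive _ _ _ psi (cst 1)); first exact: derive_cst.
have : nbhs x0 [set y | enorm (y - x0) < eps].
  apply: open_nbhs_nbhs; split; first exact: open_enorm_lt.
  by have /eqP /= -> : enorm (x0 - x0) == 0 by rewrite enorm_eq0 subrr.
by apply: filterS => y yx; apply: psi_eq1; exact: subset_closure.
Qed.

(** The two bounds are the inputs of dominated convergence: [M] dominates uniformly, [D * C x] gives
    pointwise convergence as [D] tends to 0. *)
Lemma approximate_gradients : exists M (C : 'rV[R]_d -> R), forall D, 0 < D <= 1 ->
  exists2 f : 'rV[R]_d -> R, test_function f &
    forall x i, `|(grad f x - theta x) 0 i| <= M /\ `|(grad f x - theta x) 0 i| <= D * C x.
Proof.
have V0 : 0 <= V by apply: sumr_ge0 => i _; exact: normr_ge0.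
have vV i : `|theta x0 0 i| <= V.
  by rewrite /V (bigD1 i)//= lerDl; apply: sumr_ge0.
pose B' := Num.max B 0.
have B'0 : 0 <= B' by rewrite le_max lexx orbT.
exists (B' * (1 + V) + (1 + 3 * V)).
exists (fun x => B' * (1 + V) + (1 + 3 * V) / enorm (x - x0)).
move=> D /andP[D0 D1]; pose g := regnorm x0 (theta x0) D.
exists (fun x => psi x * g x).
  by apply: test_function_mul => n; exact: Ck_regnorm.
move=> x i; rewrite !mxE /partial.
have [_ ->] := is_derive_mulf (psi_derive x i) (is_derive_regnorm x0 (theta x0) D0 x i).
have k0 := reginv_gt0 x0 D0 x; have k2 := reginv_sqr x0 D0 x.
have V1 : 0 <= 1 + V by rewrite addr_ge0.
have V13 : 0 <= 1 + 3 * V by rewrite addr_ge0// mulr_ge0.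
have BV0 : 0 <= B' * (1 + V) by rewrite mulr_ge0.
(* At the centre [psi = 1] with zero gradient and [reginv ^+ 2 * D ^+ 2 = 1], so the error is
   exactly 0; there [C] reads [0^-1] as 0. *)
move: k0 k2; have [->|xx0] := eqVneq x x0 => k0 k2.
  move: k2; have /eqP s0 : enorm (x0 - x0) == 0 by rewrite enorm_eq0 subrr.
  rewrite partial_psi_center s0 expr0n /= add0r => k2.
  rewrite psi_eq1; last by apply: subset_closure; rewrite /eball /= s0.
  have -> : (x0 - x0) 0 i = 0 by rewrite subrr mxE.
  have -> : 0 * g x0 + 1 * (0 * reginv x0 D x0 + D ^+ 2 * (reginv x0 D x0 ^+ 2 * theta x0 0 i -
      2 * 0 * reginv x0 D x0 ^+ 4 * reglin x0 (theta x0) x0)) - theta x0 0 i =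
      (reginv x0 D x0 ^+ 2 * D ^+ 2) * theta x0 0 i - theta x0 0 i by ring.
  rewrite k2 mul1r subrr normr0 invr0 mulr0 addr0; split.
    by rewrite addr_ge0.
  by rewrite mulr_ge0// ltW.
have s0 : 0 < enorm (x - x0) by rewrite enormB_gt0.
rewrite (theta_coord i xx0) /g /regnorm regsqE.
have ls : `|reglin x0 (theta x0) x| <= V * enorm (x - x0).
  rewrite /reglin /V mulr_suml; apply: le_trans (ler_norm_sum _ _ _) _.
  apply: ler_sum => j _; rewrite normrM ler_wpM2l//.
  by have := le_coord_enorm (x - x0) j; rewrite !mxE.
have aB : `|partial psi i x| <= B' by rewrite le_max psi_B.
have E := regularized_gradient_error s0 D0 k0 k2
  (le_coord_enorm (x - x0) i) ls (vV i) aB (psi_01 x).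
have kk : (enorm (x - x0) * reginv x0 D x) ^+ 2 + (D * reginv x0 D x) ^+ 2 = 1.
  by rewrite -[RHS]k2; ring.
have Dk0 : 0 <= D * reginv x0 D x by rewrite mulr_ge0 ?ltW.
have sk0 : 0 <= enorm (x - x0) * reginv x0 D x by rewrite mulr_ge0 ?ltW.
have Dk1 : D * reginv x0 D x <= 1.
  by rewrite -(@ler_pXn2r _ 2)// ?nnegrE// expr1n -kk lerDr sqr_ge0.
have sk1 : enorm (x - x0) * reginv x0 D x <= 1.
  by rewrite -(@ler_pXn2r _ 2)// ?nnegrE// expr1n -kk lerDl sqr_ge0.
split; apply: (le_trans E).
  rewrite lerD//; last by rewrite ler_piMl.
  by rewrite ler_wpM2l// ler_piMl// addr_ge0.
(* Off the centre, [s * k <= 1] turns [D * k] into at most [D / s]. *)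
rewrite [leRHS]mulrDr lerD//; first by rewrite mulrCA.
rewrite -mulrA ler_pM2l// mulrC ler_wpM2l//.
by rewrite -[_^-1]mul1r ler_pdivlMr// mulrC.
Qed.

End approximate_potential.

(** * From pointwise to mean-square convergence *)

Section tangent.
Context {R : realType} {d : nat}.
Variable mu : probability (borelRd R d) R.
Implicit Types (v theta : 'rV[R]_d -> 'rV[R]_d).

Lemma L2norm_lt v (e : R) : 0 < e ->
  (\int[mu]_x (enorm (v x) ^+ 2)%:E < (e ^+ 2)%:E)%E -> (L2norm mu v < e%:E)%E.
Proof.
move=> e0; rewrite !ltNge; apply: contra => eN.
have H : (L2norm mu v `^ 2 = \int[mu]_x (enorm (v x) ^+ 2)%:E)%E.
  rewrite poweR_Lnorm//; apply: eq_integral => x _.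
  by rewrite gee0_abs ?lee_fin ?enorm_ge0// poweR_EFin powR_mulrn ?enorm_ge0.
rewrite -H -(powR_mulrn 2 (ltW e0)) -poweR_EFin.
by apply: gt0_ler_poweR eN => //; rewrite in_itv /= leey ?andbT ?Lnorm_ge0 ?lee_fin ?(ltW e0).
Qed.

Lemma measurable_sqr_enorm_coord v :
  (forall i, measurable_fun setT (fun x : borelRd R d => v x 0 i)) ->
  measurable_fun setT (fun x : borelRd R d => enorm (v x) ^+ 2).
Proof.
move=> mv; have -> : (fun x : borelRd R d => enorm (v x) ^+ 2) =
    (fun x => \sum_i (v x 0 i) ^+ 2).
  by apply/funext => x; rewrite sqr_enorm.
by apply: measurable_sum => i; exact: measurable_funX.
Qed.

(** Dominated convergence for the squared errors along [D = 1 / (n + 1)], with the constant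
    [d * M^2] as majorant, integrable because [mu] is finite. *)
Lemma gradient_limit_tangent theta (b M : R) (C : 'rV[R]_d -> R) :
  measurable_fun setT (theta : borelRd R d -> borelRd R d) ->
  (forall x, enorm (theta x) ^+ 2 <= b) ->
  (forall D, 0 < D <= 1 -> exists2 f : 'rV[R]_d -> R, test_function f &
    forall x i, `|(grad f x - theta x) 0 i| <= M /\ `|(grad f x - theta x) 0 i| <= D * C x) ->
  tangent_space mu theta.
Proof.
move=> mtheta theta_b H.
have mcoord i : measurable_fun setT (fun x : borelRd R d => theta x 0 i).
  have mc : measurable_fun setT (fun x : borelRd R d => (x : 'rV[R]_d) 0 i).
    by apply: measurable_continuous_real; exact: coord_continuous.
  exact: (measurableT_comp mc mtheta).
split => //.
  have b0 : 0 <= b by apply: le_trans (theta_b 0); exact: sqr_ge0.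
  apply: (@lt_trans _ _ (b + 1)%:E); last exact: ltry.
  apply: L2norm_lt; first by rewrite ltr_wpDl.
  apply: (@le_lt_trans _ _ (\int[mu]_x (cst b%:E x))%E).
    apply: ge0_le_integral => //.
    - by move=> x _; rewrite lee_fin sqr_ge0.
    - by apply/measurable_EFinP; exact: measurable_sqr_enorm_coord.
    - by move=> x _; rewrite lee_fin.
  rewrite integral_cst// [X in (_ * X)%E](_ : _ = 1%E); last exact: probability_setT.
  by rewrite mule1 lte_fin; nra.
move=> e e0.
have Dn (n : nat) : 0 < (n.+1%:R^-1 : R) <= 1.
  by rewrite invr_gt0 ltr0n /= invf_le1 ?ltr0n// ler1n.
have Hn (n : nat) : exists f : 'rV[R]_d -> R, test_function f /\
    forall x i, `|(grad f x - theta x) 0 i| <= M /\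
      `|(grad f x - theta x) 0 i| <= n.+1%:R^-1 * C x.
  by have [f tf Hf] := H _ (Dn n); exists f.
have [F HF] := boolp.choice Hn.
pose u n (x : borelRd R d) := enorm (grad (F n) x - theta x) ^+ 2.
have mu_ n : measurable_fun setT (fun x => (u n x)%:E).
  apply/measurable_EFinP; apply: measurable_sqr_enorm_coord => i.
  have -> : (fun x : borelRd R d => (grad (F n) x - theta x) 0 i) =
      (fun x => partial (F n) i x - theta x 0 i).
    by apply/funext => x; rewrite !mxE.
  apply: measurable_funB => //; apply: measurable_continuous_real.
  exact: ((HF n).1.1 [:: i]).1.
have u0 x : (u n x)%:E @[n --> \oo] --> 0%:E.
  apply: cvg_EFin; first exact: nearW.
  rewrite (_ : fine \o _ = fun n => u n x)//.
  (* Of the two factors [1 / (n + 1)] in the square, one is bounded by 1 and the other is kept as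
     [harmonic n]. *)
  apply: (@squeeze_cvgr _ _ _ _ (fun _ => 0) (fun n => d%:R * C x ^+ 2 * harmonic n)).
  - apply: nearW => n; rewrite sqr_ge0 /=.
    apply: (@le_trans _ _ (d%:R * (n.+1%:R^-1 * C x) ^+ 2)).
      by apply: le_enorm_bound => i; exact: ((HF n).2 x i).2.
    rewrite -mulrA ler_wpM2l// exprMn [leLHS]mulrC ler_wpM2l ?sqr_ge0//.
    have /andP[D0 D1] := Dn n.
    by rewrite expr2 ler_piMr// ltW.
  - exact: cvg_cst.
  - rewrite -[X in _ --> X](mulr0 (d%:R * C x ^+ 2)).
    by apply: cvgMr; exact: cvg_harmonic.
have ae0 : {ae mu, forall x, [set: borelRd R d] x -> (u n x)%:E @[n --> \oo] --> cst 0%:E x}.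
  by apply: aeW => x _; exact: u0.
have aeM : {ae mu, forall x n, [set: borelRd R d] x ->
    (`|(u n x)%:E| <= (EFin \o cst (d%:R * M ^+ 2)%R) x)%E}.
  apply: aeW => x n _; rewrite gee0_abs ?lee_fin ?sqr_ge0//.
  by apply: le_enorm_bound => i; exact: ((HF n).2 x i).1.
have ig := finite_measure_integrable_cst mu (d%:R * M ^+ 2) measurableT.
have [_ _ cvg0] := dominated_convergence measurableT mu_ (measurable_cst _) ae0 ig aeM.
rewrite integral0 in cvg0.
have e2 : (0%:E < (e ^+ 2)%:E)%E by rewrite lte_fin exprn_gt0.
have [N _ HN] := cvg0 _ (open_ereal_lt' e2).
exists (F N); first exact: (HF N).1.
by apply: L2norm_lt => //; exact: (HN N (leqnn N)).
Qed.

End tangent.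

(** * Existence and uniqueness of Peano derivatives *)

Section peano_derivative.
Context {R : realType}.
Implicit Types (f : R -> R) (L : R).

Lemma iter_rderive_peano n f L : (0 < n)%N ->
  is_iter_rderive n f 0 L -> is_peano_rderive n f 0 L.
Proof.
case: n => // n _ [g [g0 gL gd gq]]; exists (fun k => g k 0); split; rewrite ?g0//.
have H := taylor_peano (g := g) gd gq.
by apply: cvg_right0_ext H => h _; rewrite g0 add0r.
Qed.

(** Two Taylor polynomials of the same function differ by a polynomial that is [o(h^n)], whose
    coefficients vanish. *)
Lemma peano_rderive_unique n f L L' :
  is_peano_rderive n f 0 L -> is_peano_rderive n f 0 L' -> L = L'.
Proof.
move=> [c [_ cL Hc]] [c' [_ cL' Hc']].
have : (\sum_(k < n.+1) ((c' k - c k) / k`!%:R) * h ^+ k) / h ^+ n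
    @[h --> (0 : R)^'+] --> (0 : R).
  pose Q (b : nat -> R) (h : R) := (f (0 + h) - \sum_(k < n.+1) b k / k`!%:R * h ^+ k) / h ^+ n.
  have H : Q c h - Q c' h @[h --> (0 : R)^'+] --> (0 - 0 : R) by exact: cvgB.
  rewrite subrr in H; apply: cvg_right0_ext H => h _; rewrite /Q.
  have E (a b b' : R) : a - b - (a - b') = b' - b by ring.
  rewrite -mulrBl E -sumrB; congr (_ / _).
  by apply: eq_bigr => k _; ring.
move=> /(@peano_polynomial_eq0 R n (fun k => (c' k - c k) / k`!%:R)) /(_ n (leqnn n)) /eqP.
rewrite mulf_eq0 invr_eq0 pnatr_eq0 (gtn_eqF (fact_gt0 n)) orbF subr_eq0 => /eqP.
by rewrite cL cL'.
Qed.

(** The coefficients strictly between 0 and [n] are taken to be 0; the factorial compensates the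
    division by [n!] in the expansion. *)
Lemma peano_rderive_of_quotient n f (A : R) : (0 < n)%N ->
  (f h - f 0) / h ^+ n @[h --> (0 : R)^'+] --> A ->
  is_peano_rderive n f 0 (A * n`!%:R).
Proof.
move=> n0 fA.
exists (fun k => if k == 0%N then f 0 else if k == n then A * n`!%:R else 0).
split; rewrite ?eqxx ?(gtn_eqF n0)//.
have H : (f h - f 0) / h ^+ n - A @[h --> (0 : R)^'+] --> (A - A : R).
  exact: (cvgB fA (cvg_cst _)).
rewrite subrr in H; apply: cvg_right0_ext H => h h0; rewrite add0r.
case: n n0 fA => // n _ _.
rewrite big_ord_recr big_ord_recl /= big1 => [|i _]; last first.
  rewrite /bump /= add1n eqSS (ltn_eqF (ltn_ord i)).
  by rewrite !mul0r.
rewrite fact0 invr1 expr0 !mulr1 addr0 eqxx.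
have h1 : h ^+ n.+1 != 0 by rewrite expf_neq0// gt_eqF.
have f1 : (n.+1`!%:R : R) != 0 by rewrite pnatr_eq0 -lt0n fact_gt0.
by rewrite mulfK// opprD addrA [RHS]mulrBl mulfK.
Qed.

End peano_derivative.

(** * The hole of radius zero and the assembly of the result *)

Section perforation.
Context {R : realType} {d : nat}.

Lemma perforate0 (Om : set 'rV[R]_d) z : perforate Om z 0 = Om.
Proof.
rewrite /perforate (_ : eball z 0 = set0) ?closure0 ?setD0//.
by apply/seteqP; split=> // x /=; rewrite /eball /= ltNge enorm_ge0.
Qed.

End perforation.

Unset Implicit Arguments.
Set Strict Implicit.

Theorem proposition3 (R : realType) (d : nat) (d_gt0 : (0 < d)%N)
  (Oad : set (set 'rV[R]_d)) (Oad_open : forall U, Oad U -> open U)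
  (J : set 'rV[R]_d -> R)
  (Omega : set 'rV[R]_d)
  (J_top : admits_topological_derivative Oad J Omega)
  (mu : probability (borelRd R d) R) (mu_P2 : P2 mu)
  (mu_Omega : supp_int mu = Omega)
  (x0 : 'rV[R]_d) (x0_Omega : Omega x0)
  (eps : R) (eps_gt0 : 0 < eps)
  (eps_Omega : closure (eball x0 (2 * eps)) `<=` Omega)
  (psi : 'rV[R]_d -> R) (psi_test : test_function psi)
  (psi_radial : forall x y, enorm (x - x0) = enorm (y - x0) -> psi x = psi y)
  (psi_eq1 : forall x, closure (eball x0 eps) x -> psi x = 1)
  (psi_eq0 : forall x, closure (~` eball x0 (2 * eps)) x -> psi x = 0)
  (psi_01 : forall x, 0 <= psi x <= 1)
  (theta : 'rV[R]_d -> 'rV[R]_d)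
  (thetaE : forall x, x != x0 ->
     theta x = grad (fun y => psi y * enorm (y - x0)) x)
  (Phi : R -> 'rV[R]_d -> 'rV[R]_d) (Phi_flow : flow_off x0 theta Phi)
  (alpha : R) (alpha_gt0 : 0 < alpha)
  (alphaE : forall r : R, 0 < r ->
     lebesgue_volume (@eball R d 0 r) = (alpha * r ^+ d)%:E) :
  let mu_ t := pushforward mu (Phi t : borelRd R d -> borelRd R d) in
  let dT := topological_derivative J Omega x0 in
  [/\ tangent_space mu theta,
      exists2 delta : R, 0 < delta &
        forall t, 0 <= t < delta -> Pad Oad (mu_ t),
      exists2 L : R, is_peano_rderive d (fun t => Jtilde J (mu_ t)) 0 L &
        (alpha * d`!%:R)^-1 * L = dT &
      forall L : R, is_iter_rderive d (fun t => Jtilde J (mu_ t)) 0 L ->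
        (alpha * d`!%:R)^-1 * L = dT].
Proof.
move=> mu_ dT.
have [p [p1 [B [K [psiE [cp1 dp] p1B h_lip [p_one p_zero]]]]]] :=
  radial_profile d_gt0 eps_gt0 psi_test.1 psi_radial psi_eq1 psi_eq0.
pose h r := p r + r * p1 r.
have h_one r : 0 < r < eps -> h r = 1.
  move=> /andP[r0 re]; have [|pr p1r] := p_one r; first by rewrite ltW.
  by rewrite /h pr p1r mulr0 addr0.
have h_zero r : 2 * eps <= r -> h r = 0.
  by move=> /p_zero[pr p1r]; rewrite /h pr p1r mulr0 addr0.
have theta_radial x : x != x0 ->
    theta x = (h (enorm (x - x0)) / enorm (x - x0)) *: (x - x0).
  by move=> xx0; rewrite thetaE//; exact: grad_radial.
have h_cont r : 0 < r -> {for r, continuous h}.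
  move=> _; have cp : {for r, continuous p} := is_derive1_continuous (dp r).
  exact: (cvgD cp (cvgM (@cvg_id _ _) (cp1 r))).
have theta_cont x : x != x0 -> {for x, continuous theta}.
  apply: (@radial_continuous _ _ x0 0 theta h) => // y yx0.
  by rewrite add0r theta_radial.
have e2_gt0 : 0 < 2 * eps by rewrite mulr_gt0.
have K0 := lipschitz_ge0 h_lip.
(* Off [x0] the length of [theta] is [|h|], bounded by comparing with the zero of [h] at [2 * eps];
   the value at [x0] is arbitrary and enters separately. *)
have theta_bound x : enorm (theta x) ^+ 2 <= (K * (2 * eps)) ^+ 2 + enorm (theta x0) ^+ 2.
  have [->|xx0] := eqVneq x x0; first by rewrite lerDr sqr_ge0.
  apply: ler_wpDr; first exact: sqr_ge0.
  have s0 : 0 < enorm (x - x0) by rewrite enormB_gt0.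
  rewrite theta_radial// enormZ normrM normfV (gtr0_norm s0) divfK ?gt_eqF//.
  have KE0 : 0 <= K * (2 * eps) by rewrite mulr_ge0// ltW.
  suff : `|h (enorm (x - x0))| <= K * (2 * eps) by move=> hK; rewrite lerXn2r ?nnegrE.
  have [re|re] := leP (2 * eps) (enorm (x - x0)).
    by rewrite h_zero// normr0.
  rewrite -[h _]subr0 -(h_zero _ (lexx _)); apply: le_trans (h_lip _ _) _.
  rewrite ler_wpM2l// distrC gtr0_norm ?subr_gt0// lerBlDr lerDl.
  exact: enorm_ge0.
have psi_B x i : x != x0 -> `|partial psi i x| <= B.
  move=> xx0; have -> : psi = (fun y => p (enorm (y - x0))) by apply/funext.
  have [_ H] := is_derive_comp_along (dp _) (is_derive_enormB_delta i xx0).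
  have s0 : 0 < enorm (x - x0) by rewrite enormB_gt0.
  rewrite /partial H -[B]mulr1; apply: le_norm_mul; first exact: p1B.
  by rewrite normrM normfV (gtr0_norm s0) ler_pdivrMr// mul1r le_coord_enorm.
have tangent : tangent_space mu theta.
  have [M [C HMC]] := approximate_gradients eps_gt0 psi_test psi_eq1 psi_01 psi_B thetaE.
  apply: (gradient_limit_tangent mu _ theta_bound HMC).
  exact: measurable_continuous_off theta_cont.
have eps_supp : closure (eball x0 (2 * eps)) `<=` supp_int mu by rewrite mu_Omega.
have Phi_facts t : 0 <= t < eps ->
    supp_int (mu_ t) = perforate Omega x0 t /\
    exists2 P : probability (borelRd R d) R, P2 P & mu_ t = P.
  move=> te; have /andP[t0 _] := te.
  have [sigma [FE sc sgt [sfar snear] ssurj]] :=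
    flow_map d_gt0 eps_gt0 h_lip h_one h_zero theta_radial Phi_flow te.
  split.
    rewrite -mu_Omega.
    exact: (supp_int_flow d_gt0 eps_gt0 t0 FE sc sgt sfar snear ssurj eps_supp).
  apply: (pushforward_P2 mu_P2 (flow_measurable FE sc)) => x.
  exact: (flow_displacement eps_gt0 t0 FE sgt sfar snear).
have [Ad_Omega top_Omega] := J_top.
have [near_Oad J_cvg] := top_Omega x0 x0_Omega.
have Jt t : 0 <= t < eps -> Jtilde J (mu_ t) = J (perforate Omega x0 t).
  by move=> te; rewrite /Jtilde (Phi_facts t te).1.
have J0 : Jtilde J (mu_ 0) = J Omega by rewrite Jt ?lexx// perforate0.
(* A hole of radius [t] has volume [alpha * t ^+ d], so [alpha * dT] is the coefficient of [t ^+ d]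
   in the expansion. *)
pose L := alpha * dT * d`!%:R.
have quotient : (Jtilde J (mu_ t) - Jtilde J (mu_ 0)) / t ^+ d
    @[t --> (0 : R)^'+] --> alpha * dT.
  have H : alpha * topological_quotient J Omega x0 t @[t --> (0 : R)^'+] --> alpha * dT.
    by apply: cvgMr; exact: J_cvg.
  apply/cvg_right0P => e e0; have /cvg_right0P/(_ e e0)[D D0 HD] := H.
  (* The support is identified with the perforated domain only for [t < eps]. *)
  exists (Num.min D eps); first by rewrite lt_min D0.
  move=> t /andP[t0]; rewrite lt_min => /andP[tD te].
  have := HD t; rewrite t0 tD => /(_ isT); rewrite J0 Jt ?te ?ltW//.
  rewrite /topological_quotient alphaE//=; congr (`|_ - _| < _).
  by field; rewrite ?(gt_eqF alpha_gt0)// ?expf_neq0// ?(gt_eqF t0).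
have peano : is_peano_rderive d (fun t => Jtilde J (mu_ t)) 0 L.
  exact: peano_rderive_of_quotient.
have L_dT : (alpha * d`!%:R)^-1 * L = dT.
  have f0 : (d`!%:R : R) != 0 by rewrite pnatr_eq0 -lt0n fact_gt0.
  by rewrite /L; field; rewrite f0 gt_eqF.
split => //.
- have /near_rightP[D D0 HD] := near_Oad.
  exists (Num.min D eps); first by rewrite lt_min D0.
  move=> t /andP[t0]; rewrite lt_min => /andP[tD te].
  have te' : 0 <= t < eps by rewrite t0.
  have [St Pt] := Phi_facts t te'; split=> //; rewrite St.
  (* At time 0 the domain is [Omega], admissible by assumption; positive times are covered by the
     admissibility of small perforations. *)
  move: t0; rewrite le_eqVlt => /predU1P[<-|t0]; first by rewrite perforate0.
  by have := HD t; rewrite t0 tD add0r; exact.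
- by exists L.
- move=> L' HL'; rewrite -L_dT; congr (_ * _).
  apply: (peano_rderive_unique _ peano).
  exact: iter_rderive_peano.
Qed.
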